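(* Let $\mathcal{M}$ be an ensemble of $m$ binary classifiers and let $M\in\mathcal{M}$. Let $\mathcal{D}$ be a labeled dataset of $n$ data points correctly classified by the ensemble. For $i=1,\dots,n$ let $\Delta\Phi^{i,+}_M=\widehat{\Phi}^{i,+}_M-\Phi^{i,+}_M$ be the Shapley value approximation error of $M$ in the ensemble game of the $i$-th data point, where $\widehat{\Phi}^{i,+}_M$ is computed by the expected-marginal-contributions approximation, and let $\overline{\Delta\Phi}^+_M=\frac{1}{n}\sum_{i=1}^n \Delta\Phi^{i,+}_M$. If $\Delta\Phi^{1,+}_M,\dots,\Delta\Phi^{n,+}_M$ are independent random variables, then for every $\varepsilon>0$, $$P\left(\left|\overline{\Delta\Phi}^+_M-\mathbb{E}\left[\overline{\Delta\Phi}^+_M\right]\right|\geq\varepsilon\right)\leq 2\exp\left(-\sqrt{\frac{n^2\cdot m\cdot\varepsilon^4\cdot\pi}{8}}\right).$$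
   Context: Ensemble game: for a labeled data point $(\mathbf{x},y)$ and an ensemble $\mathcal{M}=\{M_1,\dots,M_m\}$ of binary classifiers, each model $M_j$ receives an individual nonnegative weight $w_j$ computed from its prediction on $\mathbf{x}$ and the label $y$ (its support for the correct label). Given a cutoff $0\le\gamma\le1$, the ensemble game is the weighted voting game on the player set $\mathcal{M}$ in which a coalition $S\subseteq\mathcal{M}$ has value $1$ if $\sum_{j\in S}w_j\geq\gamma$ and $0$ otherwise. $\Phi^{i,+}_M$ denotes the exact Shapley value of $M$ in the ensemble game of the $i$-th data point. The expected-marginal-contributions approximation (Fatima et al.) estimates the Shapley value of a player by summing, over all coalition sizes, the expected marginal contribution of the player to a random coalition of that size, computed using the mean and variance of the weights under a normal approximation; it is known that for this approximation in a weighted voting game with $m$ players the error satisfies $-\sqrt{8/(m\pi)}\le\Delta\Phi^+_M\le\sqrt{8/(m\pi)}$. *)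

(* Defs.v *)
From HB Require Import structures.
From mathcomp Require Import all_boot all_order all_algebra.
From mathcomp Require Import all_classical all_reals all_analysis.
Set Implicit Arguments. Unset Strict Implicit. Unset Printing Implicit Defensive.
Import Order.TTheory GRing.Theory Num.Theory.
Local Open Scope ring_scope.
Local Open Scope classical_set_scope.

Section EnsembleGame.
Context {R : realType} {m : nat}.
Implicit Types (w : 'I_m -> R) (gamma : R) (S : {set 'I_m}).

Definition ensemble_game w gamma S : R :=
  if gamma <= \sum_(j in S) w j then 1 else 0.

Definition shapley_value w gamma (M : 'I_m) : R :=
  \sum_(S : {set 'I_m} | M \notin S)
    (((#|S|) `! * (m - #|S| - 1) `!)%:R / (m `!)%:R) *
    (ensemble_game w gamma (M |: S) - ensemble_game w gamma S).

Definition weight_mean w : R := (\sum_j w j) / m%:R.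
Definition weight_var w : R := (\sum_j (w j - weight_mean w) ^+ 2) / m%:R.

(* Expected marginal contribution of M to a random coalition of size k
   (formed from the other players), under the normal approximation: the
   total weight of the coalition is approximated by N(k*mean, k*var) and M is
   pivotal iff that total lies in [gamma - w M, gamma).  When the variance
   k*var is 0 the distribution degenerates to the point mass at k*mean. *)
Definition exp_marg_contrib w gamma (M : 'I_m) (k : nat) : R :=
  let mu := k%:R * weight_mean w in
  let nu := k%:R * weight_var w in
  if nu == 0 then (if (gamma - w M <= mu) && (mu < gamma) then 1 else 0)
  else fine (normal_prob mu (Num.sqrt nu) `[gamma - w M, gamma[).

(* Expected-marginal-contributions approximation (Fatima et al.). *)
Definition approx_shapley_value w gamma (M : 'I_m) : R :=
  \sum_(k < m) exp_marg_contrib w gamma M k / m%:R.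

Definition shapley_approx_error w gamma (M : 'I_m) : R :=
  approx_shapley_value w gamma M - shapley_value w gamma M.

End EnsembleGame.

Definition independent_rvs {d} {T : measurableType d} {R : realType}
  (P : probability T R) (n : nat) (X : 'I_n -> T -> R) : Prop :=
  (forall i, measurable_fun setT (X i)) /\
  forall B : 'I_n -> set R, (forall i, measurable (B i)) ->
    P (\bigcap_(i in [set: 'I_n]) (X i @^-1` B i)) =
    (\prod_(i < n) P (X i @^-1` B i))%E.

(* Main.v *)
(* Write c = sqrt (8 / (m pi)).  Hoeffding's inequality for independent
   variables confined to one interval of length D bounds the deviation
   probability by 2 exp (- 2 n eps^2 / D^2), so the claim follows as soon as the
   errors lie in an interval with D^2 = 2 c.  The known bound |error| <= c only
   provides D = 2 c, which is enough exactly when c <= 1 / 2, that is for m >= 11.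

   For m <= 10 the upper end is improved.  The coalition of size 0 contributes no
   error, so m * error is the sum over 1 <= k < m of
   (normal window mass at size k) - (exact frequency of M being pivotal at size k).
   Standardised windows of different sizes overlap little, which bounds the sum of
   the masses by (m - 1) / 2 + 1 + slack.  If M does not reach the cutoff alone, the
   exact frequencies sum to at least 1 when M has a veto or is a heaviest player;
   otherwise a heavier player exists, and the variance it adds brings the bound on
   the masses down to (m - 1) / 2 + slack. *)

(* With [y = sqrt (2 c)] the upper end allowed above the floor [- c] is [y - y ^ 2 / 2]. This is at
   most 1/2, and it lies between 0.48 and 0.5 for 5 <= m <= 10. So the masses minus the exact
   frequencies must sum to slightly less than m / 2, although a single mass may be close to 1. This
   is why masses are measured from 1/2: two sizes whose masses sum to at most 1 compensate each
   other, and the case analyses look for such pairs. Pairs become scarce when the window is wide,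
   but then [M] lies far above the mean, its own deviation makes the variance large, and every mass
   drops. The margins are too thin for an argument uniform in m, hence the separate cases. If [M]
   reaches the cutoff alone, the balance is different. Either the rivals weigh at least twice the
   cutoff, and sizes k and m - k compensate, or the exact frequencies are large, because of two
   complementary coalitions of rivals one must lose. *)
Require Import Defs.
From HB Require Import structures.
From mathcomp Require Import all_boot all_order all_algebra.
From mathcomp Require Import reals ring lra zify.
Set Implicit Arguments. Unset Strict Implicit. Unset Printing Implicit Defensive.
Import Order.TTheory GRing.Theory Num.Theory.
Local Open Scope ring_scope.

(** * Sums of window excesses *)

(* Window of [M]: with the mean weight scaled to 1, weight [t] and cutoff [g],
   [M] is pivotal for a coalition of size [k] when the N(k, k sigma^2) total
   lies in [g - t, g).  [F k] is the mass of that window minus 1/2 and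
   [T2 = (t / sigma)^2].  [we_mul]: if [g^2 <= j k], the standardised upper ends
   [b_j], [b_k] satisfy [b_j <= - b_k], so [Phi b_j + Phi b_k <= 1].  In [we_shift]
   and [we_disj] the two standardised windows are disjoint, and [we_flat] is a linear
   majorant of the window mass. *)
Record window_excess (R : realFieldType) (t g T2 : R) (F : nat -> R) : Prop := {
  we_half : forall k, F k <= 1 / 2;
  we_low : forall k, (0 < k)%N -> k%:R + t < g -> F k <= 0;
  we_high : forall k, (0 < k)%N -> g <= k%:R -> F k <= 0;
  we_mul : forall j k, (0 < j)%N -> (0 < k)%N -> g ^+ 2 <= j%:R * k%:R ->
    F j + F k <= 0;
  we_shift : forall j k, (0 < j)%N -> (0 < k)%N ->
    j%:R + t <= k%:R -> k%:R <= g -> F j + F k <= 0;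
  we_disj : forall j k rho, (0 < j)%N -> (0 < k)%N -> g <= k%:R -> 0 <= rho ->
    k%:R <= rho ^+ 2 * j%:R -> rho * (j%:R + t - g) <= k%:R - g -> F j + F k <= 0;
  we_flat : forall k eta, 1 < t -> (0 < k)%N -> 0 <= eta -> T2 <= eta ^+ 2 * k%:R ->
    F k <= 29 / 100 * eta - 386 / 1000 }.

Lemma mem_iota4 m : (4 <= m <= 10)%N -> m \in iota 4 7.
Proof. by rewrite mem_iota. Qed.

Definition pos_part (R : realFieldType) (F : nat -> R) k : R := Num.max (F k) 0.
Definition neg_part (R : realFieldType) (F : nat -> R) k : R := Num.max (- F k) 0.

Section Excess.
Context {R : realFieldType}.
Variables (t g T2 : R) (F : nat -> R).
Hypothesis (H : window_excess t g T2 F).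
Hypothesis (t_ge0 : 0 <= t) (lt_tg : t < g).

Notation G := (pos_part F).
Notation N := (neg_part F).

Let G_ge0 k : 0 <= G k. Proof. by rewrite le_max lexx orbT. Qed.
Let N_ge0 k : 0 <= N k. Proof. by rewrite le_max lexx orbT. Qed.
Let FGN k : F k = G k - N k.
Proof. by rewrite /pos_part /neg_part !maxEle; case: ifP; case: ifP => //; lra. Qed.

Let G_half k : G k <= 1 / 2.
Proof. rewrite ge_max (we_half H); lra. Qed.

(** The form in which every pairing property is used: an excess at size [j] is paid by the deficit
    at size [k]. *)
Let G_pair j k : F j + F k <= 0 -> G j <= N k.
Proof. by move=> h; rewrite ge_max N_ge0 andbT le_max; apply/orP; left; lra. Qed.

Let G_le0 k : F k <= 0 -> G k = 0.
Proof. by move=> h; apply/eqP; rewrite eq_le G_ge0 ge_max h lexx. Qed.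

Let G_low k : (0 < k)%N -> k%:R + t < g -> G k = 0.
Proof. by move=> k0 h; apply/G_le0/(we_low H). Qed.

Let G_high k : (0 < k)%N -> g <= k%:R -> G k = 0.
Proof. by move=> k0 h; apply/G_le0/(we_high H). Qed.

Let G_flat k eta v : 1 < t -> (0 < k)%N -> 0 <= eta -> T2 <= eta ^+ 2 * k%:R ->
  29 / 100 * eta - 386 / 1000 <= v -> 0 <= v -> G k <= v.
Proof.
move=> t1 k0 e0 h1 h2 v0; rewrite ge_max v0 andbT.
exact: le_trans (we_flat H t1 k0 e0 h1) h2.
Qed.

Let sum_F m : \sum_(1 <= k < m) F k = \sum_(1 <= k < m) G k - \sum_(1 <= k < m) N k.
Proof. by rewrite -sumrB; apply: eq_bigr => k _; exact: FGN. Qed.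

(* Positive parts beyond size [c] are paid for, one by one, by the negative
   parts [c] steps earlier, because [c >= t] makes those windows disjoint. *)
Lemma excess_bound (c m : nat) : (0 < c < m)%N -> t <= c%:R ->
  \sum_(1 <= k < m) F k <=
  \sum_(1 <= k < c.+1) G k - \sum_(m - c <= k < m) N k.
Proof.
move=> /andP[c0 cm] tc.
rewrite sum_F (big_cat_nat _ (n := c.+1) (m := 1)) //=.
rewrite (big_cat_nat _ (n := (m - c)%N) (m := 1) (p := m)) /=; [|lia|lia].
rewrite opprD addrA lerD2r -addrA gerDl subr_le0.
have -> : \sum_(c.+1 <= k < m) G k = \sum_(1 <= k < m - c) G (k + c)%N.
  by rewrite -(add1n c) big_addn.
apply: ler_sum_nat => k /andP[k1 k2].
case: (leP g (k + c)%:R) => h.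
  by rewrite G_high // ?addn_gt0 ?k1.
apply: G_pair; rewrite addrC; apply: (we_shift H) => //; rewrite ?addn_gt0 ?k1 //.
  by rewrite natrD lerD2l.
exact: ltW.
Qed.

Let G_mul j k : (0 < j)%N -> (0 < k)%N -> g ^+ 2 <= j%:R * k%:R -> G j <= N k.
Proof. by move=> j0 k0 h; apply: G_pair; exact: (we_mul H). Qed.

(** The premise [g <= k] of [we_disj] is derived here: if [j + t < g], then [G j = 0]; otherwise the
    left side of the scaled inequality is nonnegative and forces it. *)
Let G_disj rho j k : (0 < j)%N -> (0 < k)%N -> 0 <= rho ->
  k%:R <= rho ^+ 2 * j%:R ->
  (g <= j%:R + t -> rho * (j%:R + t - g) <= k%:R - g) -> G j <= N k.
Proof.
move=> j0 k0 r0 h1 h2; have [h|h] := ltP (j%:R + t) g; first by rewrite G_low.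
have h3 := h2 h; apply: G_pair; apply: (we_disj H _ _ _ r0) => //.
rewrite -subr_ge0; by apply: le_trans h3; rewrite mulr_ge0 // subr_ge0.
Qed.

(* The weight of [M] contributes to the variance, which bounds it in terms of
   [t]: [T2 <= C (t / (t - 1))^2].  The right-hand side decreases in [t], so its
   value at any [t0 <= t] is still an upper bound. *)
Variable C : R.
Hypothesis T2_le : 1 < t -> T2 * (t - 1) ^+ 2 <= C * t ^+ 2.

Let G_tail t0 v k : (0 < k)%N -> 1 < t0 -> t0 <= t -> 0 <= v ->
  C * t0 ^+ 2 <= ((v + 386 / 1000) * (100 / 29)) ^+ 2 * k%:R * (t0 - 1) ^+ 2 ->
  G k <= v.
Proof.
(* [eta] solves [29 / 100 * eta - 386 / 1000 = v], so that [we_flat] returns exactly [v]. *)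
move=> k0 t01 t0t v0 h; set eta := (v + _) * _ in h.
have e0 : 0 <= eta by rewrite /eta; lra.
have t1 : 1 < t by exact: lt_le_trans t0t.
apply: (G_flat t1 k0 e0) => //; last by rewrite /eta; lra.
have hT := T2_le t1.
rewrite -(ler_pM2r (_ : 0 < (t - 1) ^+ 2 * t0 ^+ 2)); last first.
  by rewrite mulr_gt0 // exprn_gt0 //; lra.
have k0' : 0 <= k%:R :> R by [].
have h1 : T2 * ((t - 1) ^+ 2 * t0 ^+ 2) <= C * t0 ^+ 2 * t ^+ 2.
  by have := ler_wpM2r (sqr_ge0 t0) hT; lra.
apply: (le_trans h1).
have h2 : C * t0 ^+ 2 * t ^+ 2 <= eta ^+ 2 * k%:R * ((t0 - 1) * t) ^+ 2.
  by have := ler_wpM2r (sqr_ge0 t) h; lra.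
apply: (le_trans h2).
have h4 : ((t0 - 1) * t) ^+ 2 <= ((t - 1) * t0) ^+ 2.
  by rewrite ler_pXn2r ?nnegrE ?mulr_ge0 //; lra.
by have := ler_wpM2l (mulr_ge0 (sqr_ge0 eta) k0') h4; lra.
Qed.

(* Chosen so that ((m - 1) / 2 + slack m) / m <= sqrt (2 c) - c for 5 <= m <= 10,
   where c = sqrt (8 / (m pi)); at m = 4 the lower end is - 3 / 4 instead. *)
Definition slack (m : nat) : R :=
  if m == 4 then 1 / 2 else if (m <= 6)%N then 2 / 5 else
  if m == 7 then 9 / 20 else 12 / 25.

(** Sources of bounds in the case analyses: [trim c] cancels the positive parts beyond size [c] and
    keeps [N] on the last [c] sizes, [halves] gives 1/2, [disj] and [mul] pay for size [j] out of
    [N k], and [tail k t0 v] uses the spread of a wide window. In [disj], [rho] is a rational at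
    least [sqrt (k / j)]; in [tail], [v] rounds up what [G_tail] requires at [t0]. *)
Ltac expand_sums := rewrite /index_iota /= ?big_cons ?big_nil.
Ltac halves ks := lazymatch ks with
  | (?ks', ?k) => halves ks'; halves k
  | tt => idtac
  | ?k => have := G_half k; move=> ?
  end.
Ltac nnegs ks := lazymatch ks with
  | (?ks', ?k) => nnegs ks'; nnegs k
  | tt => idtac
  | ?k => have := N_ge0 k; move=> ?
  end.
Ltac tail k t0 v :=
  have ?: G k <= v by
    apply: (@G_tail t0);
    [ exact: isT | lra | apply: ltW; assumption
    | lra
    | match goal with h : C = _ |- _ => rewrite h end; lra ].
Ltac disj rho j k :=
  have ?: G j <= N k by
    apply: (@G_disj rho);
    [ exact: isT | exact: isT | lra | lra
    | move=> ?; have := lt_tg; lra ].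
Ltac mul j k :=
  have ?: G j <= N k by apply: G_mul => //=; have := lt_tg; nra.
Ltac trim c := apply: le_trans (excess_bound (c := c) _ _) _ => //; expand_sums.

(** * Excess sums when only the weight of [M] bounds the variance *)

Let wide_window5 : 2 < t -> C = 4 -> \sum_(1 <= k < 5) F k <= 1 + 2 / 5.
Proof.
move=> t2 CE.
(* An upper bound on [t] feeds [trim], a lower one feeds [tail]; beyond the last threshold the tails
   are small enough without trimming. *)
have [t3|t3] := leP t 3.
  trim 3%N.
  tail 3%N (2:R) (3 / 10:R).
  by halves (1%N, 2%N); nnegs (2%N, 3%N, 4%N); lra.
have [t4|t4] := leP t 4.
  trim 4%N.
  tail 2%N (3:R) (24 / 100:R). tail 3%N (3:R) (12 / 100:R).
  tail 4%N (3:R) (6 / 100:R).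
  by halves (1%N); nnegs (1%N, 2%N, 3%N, 4%N); lra.
rewrite sum_F; expand_sums.
tail 1%N (4:R) (39 / 100:R). tail 2%N (4:R) (17 / 100:R).
tail 3%N (4:R) (7 / 100:R). tail 4%N (4:R) (1 / 100:R).
by nnegs (1%N, 2%N, 3%N, 4%N); lra.
Qed.

Let wide_window6 : 2 < t -> C = 5 -> \sum_(1 <= k < 6) F k <= 1 + 2 / 5.
Proof.
move=> t2 CE.
have [t3|t3] := leP t 3.
  trim 3%N.
  tail 3%N (2:R) (37 / 100:R).
  by halves (1%N, 2%N); nnegs (3%N, 4%N, 5%N); lra.
have [t4|t4] := leP t 4.
  trim 4%N.
  tail 2%N (3:R) (31 / 100:R). tail 3%N (3:R) (18 / 100:R).
  tail 4%N (3:R) (11 / 100:R).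
  by halves (1%N); nnegs (2%N, 3%N, 4%N, 5%N); lra.
rewrite sum_F; expand_sums.
tail 1%N (4:R) (48 / 100:R). tail 2%N (4:R) (23 / 100:R).
tail 3%N (4:R) (12 / 100:R). tail 4%N (4:R) (5 / 100:R).
tail 5%N (4:R) (1 / 100:R).
by nnegs (1%N, 2%N, 3%N, 4%N, 5%N); lra.
Qed.

Let wide_window7 : 2 < t -> C = 6 -> \sum_(1 <= k < 7) F k <= 1 + 9 / 20.
Proof.
move=> t2 CE.
have [t3|t3] := leP t 3.
  trim 3%N.
  disj (49 / 20:R) 1%N 6%N.
  by halves (2%N, 3%N); nnegs (4%N, 5%N); lra.
have [t4|t4] := leP t 4.
  trim 4%N.
  tail 2%N (3:R) (37 / 100:R). tail 3%N (3:R) (23 / 100:R).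
  tail 4%N (3:R) (15 / 100:R).
  by halves (1%N); nnegs (3%N, 4%N, 5%N, 6%N); lra.
rewrite sum_F; expand_sums.
tail 2%N (4:R) (29 / 100:R). tail 3%N (4:R) (17 / 100:R).
tail 4%N (4:R) (9 / 100:R). tail 5%N (4:R) (4 / 100:R).
tail 6%N (4:R) (1 / 100:R).
by halves (1%N); nnegs (1%N, 2%N, 3%N, 4%N, 5%N, 6%N); lra.
Qed.

Let wide_window8 : 2 < t -> C = 7 -> \sum_(1 <= k < 8) F k <= 1 + 12 / 25.
Proof.
move=> t2 CE.
have [t3|t3] := leP t 3.
  trim 3%N.
  disj (53 / 20:R) 1%N 7%N.
  by halves (2%N, 3%N); nnegs (5%N, 6%N); lra.
have [t4|t4] := leP t 4.
  trim 4%N.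
  tail 2%N (3:R) (43 / 100:R). tail 3%N (3:R) (28 / 100:R).
  tail 4%N (3:R) (19 / 100:R).
  by halves (1%N); nnegs (4%N, 5%N, 6%N, 7%N); lra.
rewrite sum_F; expand_sums.
tail 2%N (4:R) (34 / 100:R). tail 3%N (4:R) (21 / 100:R).
tail 4%N (4:R) (13 / 100:R). tail 5%N (4:R) (8 / 100:R).
tail 6%N (4:R) (4 / 100:R). tail 7%N (4:R) (1 / 100:R).
by halves (1%N); nnegs (1%N, 2%N, 3%N, 4%N, 5%N, 6%N, 7%N); lra.
Qed.

Let wide_window9 : 2 < t -> C = 8 -> \sum_(1 <= k < 9) F k <= 1 + 12 / 25.
Proof.
move=> t2 CE.
have [t3|t3] := leP t 3.
  trim 3%N.
  disj (283 / 100:R) 1%N 8%N.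
  by halves (2%N, 3%N); nnegs (6%N, 7%N); lra.
have [t4|t4] := leP t 4.
  trim 4%N.
  disj (283 / 100:R) 1%N 8%N. tail 4%N (3:R) (27 / 100:R).
  by halves (2%N, 3%N); nnegs (5%N, 6%N, 7%N); lra.
rewrite sum_F; expand_sums.
have [t5|t5] := leP t 5.
  disj (283 / 100:R) 1%N 8%N. tail 2%N (4:R) (39 / 100:R).
  tail 3%N (4:R) (25 / 100:R). tail 4%N (4:R) (17 / 100:R).
  tail 5%N (4:R) (11 / 100:R). tail 6%N (4:R) (7 / 100:R).
  tail 7%N (4:R) (3 / 100:R). tail 8%N (4:R) (1 / 100:R).
  by nnegs (1%N, 2%N, 3%N, 4%N, 5%N, 6%N, 7%N); lra.
tail 2%N (5:R) (34 / 100:R). tail 3%N (5:R) (21 / 100:R).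
tail 4%N (5:R) (13 / 100:R). tail 5%N (5:R) (8 / 100:R).
tail 6%N (5:R) (4 / 100:R). tail 7%N (5:R) (1 / 100:R). tail 8%N (5:R) (0:R).
by halves (1%N); nnegs (1%N, 2%N, 3%N, 4%N, 5%N, 6%N, 7%N, 8%N); lra.
Qed.

Let wide_window10 : 2 < t -> C = 9 -> \sum_(1 <= k < 10) F k <= 1 + 12 / 25.
Proof.
move=> t2 CE.
have [t3|t3] := leP t 3.
  trim 3%N.
  disj (3:R) 1%N 9%N.
  by halves (2%N, 3%N); nnegs (7%N, 8%N); lra.
have [t4|t4] := leP t 4.
  trim 4%N.
  disj (3:R) 1%N 9%N. tail 4%N (3:R) (27 / 100:R).
  by halves (2%N, 3%N); nnegs (6%N, 7%N, 8%N); lra.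
rewrite sum_F; expand_sums.
have [t5|t5] := leP t 6.
  disj (3:R) 1%N 9%N. tail 2%N (4:R) (44 / 100:R).
  tail 3%N (4:R) (29 / 100:R). tail 4%N (4:R) (20 / 100:R).
  tail 5%N (4:R) (14 / 100:R). tail 6%N (4:R) (9 / 100:R).
  tail 7%N (4:R) (6 / 100:R). tail 8%N (4:R) (3 / 100:R).
  tail 9%N (4:R) (1 / 100:R).
  by nnegs (1%N, 2%N, 3%N, 4%N, 5%N, 6%N, 7%N, 8%N); lra.
tail 2%N (6:R) (36 / 100:R). tail 3%N (6:R) (22 / 100:R).
tail 4%N (6:R) (14 / 100:R). tail 5%N (6:R) (9 / 100:R).
tail 6%N (6:R) (5 / 100:R). tail 7%N (6:R) (1 / 100:R). tail 8%N (6:R) (0:R).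
tail 9%N (6:R) (0:R).
by halves (1%N); nnegs (1%N, 2%N, 3%N, 4%N, 5%N, 6%N, 7%N, 8%N, 9%N); lra.
Qed.

Lemma excess_le_slack_add1 (m : nat) : (4 <= m <= 10)%N -> C = m%:R - 1 ->
  \sum_(1 <= k < m) F k <= 1 + slack m.
Proof.
move=> hm CE.
(* For [t <= 2] trimming leaves sizes 1 and 2, worth 1/2 each: together they make up the summand 1
   of the bound. *)
have [t2|t2] := leP t 2.
  have m2 : (0 < 2 < m)%N by case/andP: hm => /ltnW.
  apply: (le_trans (excess_bound m2 t2)).
  have ? : 0 <= \sum_(m - 2 <= k < m) N k by apply: sumr_ge0 => k _.
  have ? : 2 / 5 <= slack m by rewrite /slack; do ?case: ifP => _; lra.
  by expand_sums; halves (1%N, 2%N); lra.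
have := mem_iota4 hm.
rewrite !inE => /or4P[|||/or4P[]] /eqP mE; rewrite mE in CE *.
- have -> : slack 4 = 1 / 2 by [].
  by rewrite sum_F; expand_sums; halves (1%N, 2%N, 3%N); nnegs (1%N, 2%N, 3%N); lra.
- have -> : slack 5 = 2 / 5 by []. by apply: wide_window5 => //; lra.
- have -> : slack 6 = 2 / 5 by []. by apply: wide_window6 => //; lra.
- have -> : slack 7 = 9 / 20 by []. by apply: wide_window7 => //; lra.
- have -> : slack 8 = 12 / 25 by []. by apply: wide_window8 => //; lra.
- have -> : slack 9 = 12 / 25 by []. by apply: wide_window9 => //; lra.
- have -> : slack 10 = 12 / 25 by []. by apply: wide_window10 => //; lra.
Qed.

(** * Excess sums when some rival is heavier than [M] *)

Let narrow_low4 : t <= 1 ->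
  \sum_(1 <= k < 4) F k <= 1 / 2.
Proof.
have ltg := lt_tg; have t0 := t_ge0; move=> t1.
(* Only size 1 survives, and it is paid by the last size, the one negative part kept; the sum is
   even nonpositive. The same pairing serves every m. *)
trim 1%N.
disj (2:R) 1%N 3%N.
by lra.
Qed.

Let narrow_low5 : t <= 1 ->
  \sum_(1 <= k < 5) F k <= 2 / 5.
Proof.
have ltg := lt_tg; have t0 := t_ge0; move=> t1.
trim 1%N.
disj (2:R) 1%N 4%N.
by lra.
Qed.

Let narrow_low6 : t <= 1 ->
  \sum_(1 <= k < 6) F k <= 2 / 5.
Proof.
have ltg := lt_tg; have t0 := t_ge0; move=> t1.
trim 1%N.
disj (9 / 4:R) 1%N 5%N.
by lra.
Qed.

Let narrow_low7 : t <= 1 ->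
  \sum_(1 <= k < 7) F k <= 9 / 20.
Proof.
have ltg := lt_tg; have t0 := t_ge0; move=> t1.
trim 1%N.
disj (5 / 2:R) 1%N 6%N.
by lra.
Qed.

Let narrow_low8 : t <= 1 ->
  \sum_(1 <= k < 8) F k <= 12 / 25.
Proof.
have ltg := lt_tg; have t0 := t_ge0; move=> t1.
trim 1%N.
disj (8 / 3:R) 1%N 7%N.
by lra.
Qed.

Let narrow_low9 : t <= 1 ->
  \sum_(1 <= k < 9) F k <= 12 / 25.
Proof.
have ltg := lt_tg; have t0 := t_ge0; move=> t1.
trim 1%N.
disj (17 / 6:R) 1%N 8%N.
by lra.
Qed.

Let narrow_low10 : t <= 1 ->
  \sum_(1 <= k < 10) F k <= 12 / 25.
Proof.
have ltg := lt_tg; have t0 := t_ge0; move=> t1.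
trim 1%N.
disj (3:R) 1%N 9%N.
by lra.
Qed.

Let narrow_mid4 : t <= 2 -> g <= 4 - t ->
  \sum_(1 <= k < 4) F k <= 1 / 2.
Proof.
have ltg := lt_tg; have t0 := t_ge0; move=> t2 gt.
(* 6 = 2 * 3 is the limit of [we_mul] for sizes 2 and 3. Above it [g] exceeds 61/25, just below
   [sqrt 6], and the windows of sizes 1 and 3 separate. *)
have [g2|g2] := leP (g ^+ 2) 6.
  trim 2%N.
  mul 2%N 3%N.
  by halves (1%N); nnegs (2%N); lra.
have g3 : 61 / 25 <= g by nra.
trim 2%N.
disj (7 / 4:R) 1%N 3%N.
by halves (2%N); nnegs (2%N); lra.
Qed.

Let narrow_mid5 : t <= 2 -> C = 3 / 2 ->
  \sum_(1 <= k < 5) F k <= 2 / 5.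
Proof.
have ltg := lt_tg; have t0 := t_ge0; move=> t2 CE.
have [t15|t15] := leP t (3 / 2); last first.
  trim 2%N.
  disj (2:R) 1%N 4%N. tail 2%N (3 / 2:R) (38 / 100:R).
  by nnegs (3%N); lra.
have [g2|g2] := leP (g ^+ 2) 6.
  trim 2%N.
  disj (2:R) 1%N 4%N. mul 2%N 3%N.
  by lra.
have g3 : 61 / 25 <= g by nra.
trim 2%N.
disj (7 / 4:R) 1%N 3%N. disj (71 / 50:R) 2%N 4%N.
by lra.
Qed.

(** From m = 6 on, size 1 is paid by size m - 2 and size 2 by size m - 1: the latter through
    [we_mul] if [g <= 3], as then [g ^ 2 <= 9 <= 2 (m - 1)], and through disjointness otherwise. *)
Let narrow_mid6 : t <= 2 ->
  \sum_(1 <= k < 6) F k <= 2 / 5.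
Proof.
have ltg := lt_tg; have t0 := t_ge0; move=> t2.
have [g3|g3] := leP g 3.
  trim 2%N.
  disj (2:R) 1%N 4%N. mul 2%N 5%N.
  by lra.
trim 2%N.
disj (2:R) 1%N 4%N. disj (8 / 5:R) 2%N 5%N.
by lra.
Qed.

Let narrow_mid7 : t <= 2 ->
  \sum_(1 <= k < 7) F k <= 9 / 20.
Proof.
have ltg := lt_tg; have t0 := t_ge0; move=> t2.
have [g3|g3] := leP g 3.
  trim 2%N.
  disj (9 / 4:R) 1%N 5%N. mul 2%N 6%N.
  by lra.
trim 2%N.
disj (9 / 4:R) 1%N 5%N. disj (7 / 4:R) 2%N 6%N.
by lra.
Qed.

Let narrow_mid8 : t <= 2 ->
  \sum_(1 <= k < 8) F k <= 12 / 25.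
Proof.
have ltg := lt_tg; have t0 := t_ge0; move=> t2.
have [g3|g3] := leP g 3.
  trim 2%N.
  disj (5 / 2:R) 1%N 6%N. mul 2%N 7%N.
  by lra.
trim 2%N.
disj (5 / 2:R) 1%N 6%N. disj (19 / 10:R) 2%N 7%N.
by lra.
Qed.

Let narrow_mid9 : t <= 2 ->
  \sum_(1 <= k < 9) F k <= 12 / 25.
Proof.
have ltg := lt_tg; have t0 := t_ge0; move=> t2.
have [g3|g3] := leP g 3.
  trim 2%N.
  disj (53 / 20:R) 1%N 7%N. mul 2%N 8%N.
  by lra.
trim 2%N.
disj (53 / 20:R) 1%N 7%N. disj (2:R) 2%N 8%N.
by lra.
Qed.

Let narrow_mid10 : t <= 2 ->
  \sum_(1 <= k < 10) F k <= 12 / 25.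
Proof.
have ltg := lt_tg; have t0 := t_ge0; move=> t2.
have [g3|g3] := leP g 3.
  trim 2%N.
  disj (283 / 100:R) 1%N 8%N. mul 2%N 9%N.
  by lra.
trim 2%N.
disj (283 / 100:R) 1%N 8%N. disj (11 / 5:R) 2%N 9%N.
by lra.
Qed.

Let narrow_high5 : 2 < t -> g <= 5 - t -> C = 3 / 2 ->
  \sum_(1 <= k < 5) F k <= 2 / 5.
Proof.
have ltg := lt_tg; have t0 := t_ge0; move=> t2 gt CE.
have t3 : t <= 3 by lra.
have [g2|g2] := leP (g ^+ 2) 6.
  have g3 : g <= 3 by nra.
  trim 3%N.
  mul 2%N 3%N. have ?: G 3 <= 0 by rewrite G_high //=; lra.
  tail 1%N (2:R) (33 / 100:R).
  by nnegs (2%N, 4%N); lra.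
have g3 : 61 / 25 <= g by nra.
have [tg|tg] := leP (2 * t) (g + 2).
  trim 3%N.
  disj (2:R) 1%N 4%N. tail 2%N (2:R) (12 / 100:R). tail 3%N (2:R) (3 / 100:R).
  by nnegs (2%N, 3%N); lra.
have t22 : 111 / 50 < t by lra.
trim 3%N.
tail 1%N (111 / 50:R) (27 / 100:R). tail 2%N (111 / 50:R) (8 / 100:R).
have ?: G 3 <= 0 by rewrite G_high //=; lra.
by nnegs (2%N, 3%N, 4%N); lra.
Qed.

Let narrow_high6 : 2 < t -> g <= 6 - t -> C = 2 ->
  \sum_(1 <= k < 6) F k <= 2 / 5.
Proof.
have ltg := lt_tg; have t0 := t_ge0; move=> t2 gt CE.
have t3 : t <= 3 by lra.
have [t4|t4] := leP t (11 / 4).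
  trim 3%N.
  disj (56 / 25:R) 1%N 5%N. tail 2%N (2:R) (20 / 100:R).
  tail 3%N (2:R) (9 / 100:R).
  by nnegs (3%N, 4%N); lra.
trim 3%N.
tail 1%N (11 / 4:R) (26 / 100:R). tail 2%N (11 / 4:R) (7 / 100:R).
tail 3%N (11 / 4:R) (0:R).
by nnegs (3%N, 4%N, 5%N); lra.
Qed.

Let narrow_high7 : 2 < t -> g <= 7 - t -> C = 5 / 2 ->
  \sum_(1 <= k < 7) F k <= 9 / 20.
Proof.
have ltg := lt_tg; have t0 := t_ge0; move=> t2 gt CE.
have [t3|t3] := leP t 3.
  trim 3%N.
  disj (49 / 20:R) 1%N 6%N. tail 2%N (2:R) (27 / 100:R).
  tail 3%N (2:R) (15 / 100:R).
  by nnegs (4%N, 5%N); lra.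
have t5 : t <= 5 by lra.
trim 5%N.
disj (49 / 20:R) 1%N 6%N. tail 2%N (3:R) (11 / 100:R).
tail 3%N (3:R) (2 / 100:R). tail 4%N (3:R) (0:R). tail 5%N (3:R) (0:R).
by nnegs (2%N, 3%N, 4%N, 5%N); lra.
Qed.

Let narrow_high8 : 2 < t -> g <= 8 - t -> C = 3 ->
  \sum_(1 <= k < 8) F k <= 12 / 25.
Proof.
have ltg := lt_tg; have t0 := t_ge0; move=> t2 gt CE.
have [t3|t3] := leP t 3; last first.
  have t5 : t <= 5 by lra.
  trim 5%N.
  disj (53 / 20:R) 1%N 7%N. tail 2%N (3:R) (15 / 100:R).
  tail 3%N (3:R) (5 / 100:R). tail 4%N (3:R) (0:R). tail 5%N (3:R) (0:R).
  by nnegs (3%N, 4%N, 5%N, 6%N); lra.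
(* The threshold 11/5 makes [g <= 2 + t] imply [g ^ 2 <= 18 = 3 * 6], as [mul 3 6] requires; if
   [g > 2 + t], size 2 has no excess. *)
have [th|th] := leP t (11 / 5); last first.
  trim 3%N.
  disj (53 / 20:R) 1%N 7%N. tail 2%N (11 / 5:R) (27 / 100:R).
  tail 3%N (11 / 5:R) (15 / 100:R).
  by nnegs (5%N, 6%N); lra.
have [g2|g2] := ltP (2 + t) g.
  trim 3%N.
  disj (53 / 20:R) 1%N 7%N. have ?: G 2 <= 0 by rewrite G_low //=; lra.
  tail 3%N (2:R) (20 / 100:R).
  by nnegs (5%N, 6%N); lra.
trim 3%N.
disj (53 / 20:R) 1%N 7%N. mul 3%N 6%N. tail 2%N (2:R) (33 / 100:R).
by nnegs (5%N); lra.
Qed.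

Let narrow_high9 : 2 < t -> g <= 9 - t -> C = 7 / 2 ->
  \sum_(1 <= k < 9) F k <= 12 / 25.
Proof.
have ltg := lt_tg; have t0 := t_ge0; move=> t2 gt CE.
have [t3|t3] := leP t 3; last first.
  have t5 : t <= 5 by lra.
  trim 5%N.
  disj (283 / 100:R) 1%N 8%N. tail 2%N (3:R) (19 / 100:R).
  tail 3%N (3:R) (9 / 100:R). tail 4%N (3:R) (3 / 100:R).
  tail 5%N (3:R) (0:R).
  by nnegs (4%N, 5%N, 6%N, 7%N); lra.
have [th|th] := leP t (5 / 2); last first.
  trim 3%N.
  disj (283 / 100:R) 1%N 8%N. tail 2%N (5 / 2:R) (26 / 100:R).
  tail 3%N (5 / 2:R) (14 / 100:R).
  by nnegs (6%N, 7%N); lra.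
have [g2|g2] := ltP (2 + t) g.
  trim 3%N.
  disj (283 / 100:R) 1%N 8%N. have ?: G 2 <= 0 by rewrite G_low //=; lra.
  tail 3%N (2:R) (25 / 100:R).
  by nnegs (6%N, 7%N); lra.
trim 3%N.
disj (283 / 100:R) 1%N 8%N. mul 3%N 7%N. tail 2%N (2:R) (39 / 100:R).
by nnegs (6%N); lra.
Qed.

Let narrow_high10 : 2 < t -> g <= 10 - t -> C = 4 ->
  \sum_(1 <= k < 10) F k <= 12 / 25.
Proof.
have ltg := lt_tg; have t0 := t_ge0; move=> t2 gt CE.
have [t3|t3] := leP t 3; last first.
  have t5 : t <= 5 by lra.
  trim 5%N.
  disj (3:R) 1%N 9%N. tail 2%N (3:R) (23 / 100:R).
  tail 3%N (3:R) (12 / 100:R). tail 4%N (3:R) (5 / 100:R).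
  tail 5%N (3:R) (1 / 100:R).
  by nnegs (5%N, 6%N, 7%N, 8%N); lra.
have [th|th] := leP t (5 / 2); last first.
  trim 3%N.
  disj (3:R) 1%N 9%N. tail 2%N (5 / 2:R) (299 / 1000:R).
  tail 3%N (5 / 2:R) (174 / 1000:R).
  by nnegs (7%N, 8%N); lra.
have [g2|g2] := ltP (2 + t) g.
  trim 3%N.
  disj (3:R) 1%N 9%N. have ?: G 2 <= 0 by rewrite G_low //=; lra.
  tail 3%N (2:R) (29 / 100:R).
  by nnegs (7%N, 8%N); lra.
trim 3%N.
disj (3:R) 1%N 9%N. mul 3%N 8%N. tail 2%N (2:R) (44 / 100:R).
by nnegs (7%N); lra.
Qed.

(** [C = (m - 2) / 2] is the constant of [window_scale2], and [g <= m - t] says that the rivals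
    together reach the cutoff. With [t < g] it confines [t] to [t < m / 2]. *)
Lemma excess_le_slack (m : nat) : (4 <= m <= 10)%N -> C = (m%:R - 2) / 2 ->
  g <= m%:R - t -> \sum_(1 <= k < m) F k <= slack m.
Proof.
move=> hm CE gt; have ltg := lt_tg.
have := mem_iota4 hm.
rewrite !inE => /or4P[|||/or4P[]] /eqP mE; rewrite mE in CE gt *.
- have -> : slack 4 = 1 / 2 by [].
  have [t1|t1] := leP t 1; first exact: narrow_low4.
  by apply: narrow_mid4; lra.
- have -> : slack 5 = 2 / 5 by [].
  have [t1|t1] := leP t 1; first exact: narrow_low5.
  have [t2|t2] := leP t 2; first by apply: narrow_mid5; lra.
  by apply: narrow_high5; lra.
- have -> : slack 6 = 2 / 5 by [].
  have [t1|t1] := leP t 1; first exact: narrow_low6.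
  have [t2|t2] := leP t 2; first exact: narrow_mid6.
  by apply: narrow_high6; lra.
- have -> : slack 7 = 9 / 20 by [].
  have [t1|t1] := leP t 1; first exact: narrow_low7.
  have [t2|t2] := leP t 2; first exact: narrow_mid7.
  by apply: narrow_high7; lra.
- have -> : slack 8 = 12 / 25 by [].
  have [t1|t1] := leP t 1; first exact: narrow_low8.
  have [t2|t2] := leP t 2; first exact: narrow_mid8.
  by apply: narrow_high8; lra.
- have -> : slack 9 = 12 / 25 by [].
  have [t1|t1] := leP t 1; first exact: narrow_low9.
  have [t2|t2] := leP t 2; first exact: narrow_mid9.
  by apply: narrow_high9; lra.
- have -> : slack 10 = 12 / 25 by [].
  have [t1|t1] := leP t 1; first exact: narrow_low10.
  have [t2|t2] := leP t 2; first exact: narrow_mid10.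
  by apply: narrow_high10; lra.
Qed.
End Excess.

(** * Excess sums when [M] reaches the cutoff alone *)

Section DominantWeight.
Context {R : realFieldType}.
Variables (t g T2 : R) (F : nat -> R).
Hypothesis (H : window_excess t g T2 F).

Let sum_pairs m : (0 < m)%N ->
  (forall k, (0 < k < m)%N -> F k + F (m - k)%N <= 0) ->
  \sum_(1 <= k < m) F k <= 0.
Proof.
move=> m0 h; have e : \sum_(1 <= k < m) F k = \sum_(1 <= k < m) F (m - k)%N.
  rewrite big_nat_rev /=; apply: eq_big_nat => k hk; congr F; lia.
suff : \sum_(1 <= k < m) F k + \sum_(1 <= k < m) F k <= 0 by lra.
rewrite {2}e -big_split /=; rewrite big_nat_cond; apply: sumr_le0 => k.
by rewrite andbT => hk; exact: h.
Qed.

(** Sizes k and m - k compensate. The hypotheses give [3 g <= m], hence [g ^ 2 <= m ^ 2 / 9 <= 2 (m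
    - 2) <= k (m - k)] for 2 <= k <= m - 2, and [we_mul] applies. For the pair 1, m - 1 the product
    m - 1 can be too small, but only for m >= 8, and then the two windows are disjoint. *)
Lemma excess_le0 (m : nat) : (4 <= m <= 10)%N -> 0 <= g -> g <= t ->
  2 * g <= m%:R - t -> \sum_(1 <= k < m) F k <= 0.
Proof.
move=> hm g0 gt gm; apply: sum_pairs => [|k hk]; first by lia.

have km : (k%:R : R) + (m - k)%:R = m%:R by rewrite -natrD subnKC //; lia.
have m4 : (4%:R : R) <= m%:R by rewrite ler_nat; lia.
have m10 : (m%:R : R) <= 10%:R by rewrite ler_nat; lia.
have mid : (2 <= k <= m - 2)%N -> F k + F (m - k)%N <= 0.
  move=> hk2; apply: (we_mul H); [lia|lia|].
  have k2 : (2%:R : R) <= k%:R by rewrite ler_nat; lia.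
  have mk2 : (2%:R : R) <= (m - k)%:R by rewrite ler_nat; lia.
  have h1 : 2 * (m%:R - 2) <= k%:R * (m - k)%:R :> R.
    rewrite -km; have : 0 <= (k%:R - 2) * ((m - k)%:R - 2) :> R.
      by apply: mulr_ge0; lra.
    lra.
  have g3 : 3 * g <= m%:R by lra.
  have h2 : (3 * g) ^+ 2 <= m%:R ^+ 2 by rewrite ler_pXn2r ?nnegrE //; lra.
  have h3 : 0 <= (m%:R - 4) * (10 - m%:R) :> R by apply: mulr_ge0; lra.
  by apply: le_trans h1; lra.
have ends : F 1 + F (m - 1)%N <= 0.
  have [g1|g1] := leP (g ^+ 2) (m%:R - 1).
    by apply: (we_mul H); rewrite ?mul1r ?natrB //; lia.
  have := mem_iota4 hm; rewrite !inE => /or4P[|||/or4P[]] /eqP mE;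
    rewrite mE in gm g1 *.
  - by nra.
  - by nra.
  - by nra.
  - by nra.
  - have g2 : 264 / 100 < g by nra.
    rewrite (_ : (8 - 1)%N = 7) //.
    by apply: (we_disj H (rho := 53 / 20)) => //; lra.
  - have g2 : 282 / 100 < g by nra.
    rewrite (_ : (9 - 1)%N = 8) //.
    by apply: (we_disj H (rho := 283 / 100)) => //; lra.
  - have g2 : 3 < g by nra.
    rewrite (_ : (10 - 1)%N = 9) //.
    by apply: (we_disj H (rho := 3)) => //; lra.
have [hk2|] := boolP (2 <= k <= m - 2)%N; first exact: mid.
rewrite negb_and -!ltnNge => hk2.
have [->|->] : k = 1 \/ k = (m - 1)%N by lia.
  exact: ends.
have m1 : (1 <= m)%N by case/andP: hm => /(leq_trans (isT : 1 <= 4)%N).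
by rewrite (subKn m1) addrC.
Qed.
End DominantWeight.

(** * Pivot frequencies *)

Section CoalitionFrequency.
Context {R : realType} {m : nat}.
Variable M : 'I_m.
Implicit Types (S : {set 'I_m}) (Q : pred {set 'I_m}) (k : nat).

Definition rivals k : {set {set 'I_m}} :=
  [set S : {set 'I_m} | (M \notin S) && (#|S| == k)].

(** Probability of [Q] for a uniformly random coalition of [k] players other than [M]. For k >= m
    numerator and denominator are 0 and the quotient is 0, whence the conditions [k < m] below. *)
Definition freq Q k : R := #|[set S in rivals k | Q S]|%:R / 'C(m.-1, k)%:R.

Let m_gt0 : (0 < m)%N. Proof. by case: m M => [[]|]. Qed.

Lemma card_rivals k : #|rivals k| = 'C(m.-1, k).
Proof.
rewrite -[in RHS](card_ord m) -(cardsC1 M) -cards_draws.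
apply: eq_card => S; rewrite !inE; congr andb.
by rewrite subsetC sub1set inE.
Qed.

Let bin_gt0 k : (k < m)%N -> 0 < 'C(m.-1, k)%:R :> R.
Proof. by move=> km; rewrite ltr0n bin_gt0 -ltnS prednK. Qed.

Lemma freq_ge0 Q k : 0 <= freq Q k.
Proof. by rewrite divr_ge0. Qed.

Lemma freq_true k : (k < m)%N -> freq xpredT k = 1.
Proof.
move=> km; rewrite /freq (_ : finset _ = rivals k); last first.
  by apply/setP => S; rewrite !inE andbT.
by rewrite card_rivals divff // gt_eqF // bin_gt0.
Qed.

Lemma le_freq Q Q' k : (forall S, S \in rivals k -> Q S -> Q' S) ->
  freq Q k <= freq Q' k.
Proof.
move=> QQ'; rewrite ler_wpM2r ?invr_ge0 // ler_nat subset_leq_card //.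
by apply/subsetP => S; rewrite inE => /andP[Sk QS]; rewrite inE Sk QQ'.
Qed.

Lemma freq_le1 Q k : (k < m)%N -> freq Q k <= 1.
Proof. by move=> /freq_true <-; exact: le_freq. Qed.

Lemma freq_eq1 Q k : (k < m)%N -> (forall S, S \in rivals k -> Q S) ->
  freq Q k = 1.
Proof.
move=> km hQ; apply/eqP; rewrite eq_le freq_le1 //= -{1}(freq_true km).
by apply: le_freq => S /hQ ->.
Qed.

Lemma freq_eq0 Q k : (forall S, S \in rivals k -> ~~ Q S) -> freq Q k = 0.
Proof.
move=> hQ; rewrite /freq (_ : finset _ = set0) ?cards0 ?mul0r //.
by apply/setP => S; rewrite !inE; apply/negbTE/negP => /andP[Sk]; apply/negP/hQ; rewrite inE.
Qed.

(** Complementation among the rivals, [S] to [~: (M |: S)], injects the coalitions of size k that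
    fail [Q] into those of size m - 1 - k that satisfy [Q'], and the two binomial denominators
    agree. *)
Lemma freq_compl Q Q' k : (k < m)%N ->
  (forall S, S \in rivals k -> ~~ Q S -> Q' (~: (M |: S))) ->
  1 <= freq Q k + freq Q' (m.-1 - k).
Proof.
move=> km hQ; have km1 : (k <= m.-1)%N by rewrite -ltnS prednK.
rewrite /freq bin_sub // -mulrDl ler_pdivlMr ?bin_gt0 // mul1r -natrD ler_nat.
rewrite -(card_rivals k) -(cardsID (finset Q) (rivals k)).
rewrite (_ : rivals k :&: finset Q = [set S in rivals k | Q S]); last first.
  by apply/setP => S; rewrite !inE.
rewrite leq_add2l; have inj : {in rivals k :\: finset Q &, injective (fun S => ~: (M |: S))}.
  move=> S S'; rewrite !inE => /andP[_ /andP[MS _]] /andP[_ /andP[MS' _]].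
  move=> /setC_inj h; apply/setP => j; move/setP/(_ j): h; rewrite !inE.
  by have [->|//] := eqVneq j M; rewrite (negbTE MS) (negbTE MS').
rewrite -(card_in_imset inj) subset_leq_card //; apply/subsetP => _ /imsetP[S + ->].
rewrite !inE => /andP[nQ /andP[MS /eqP Sk]]; rewrite eqxx /= hQ ?inE ?MS ?Sk //= andbT.
by rewrite cardsCs setCK cardsU1 MS Sk card_ord -subn1 subnDA.
Qed.

(* Double counting of the pairs (S, j) with j outside S. *)
Lemma freq_step Q Q' k : (k.+1 < m)%N ->
  (forall S j, S \in rivals k -> Q S -> j \notin S -> j != M -> Q' (j |: S)) ->
  freq Q k <= freq Q' k.+1.
Proof.
move=> km hQ.
have km' : (k < m)%N by exact: ltnW.
pose A := [set S in rivals k | Q S]; pose B := [set S in rivals k.+1 | Q' S].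
have cnt : (#|A| * (m.-1 - k) <= #|B| * k.+1)%N.
  pose PA := [set p : {set 'I_m} * 'I_m | (p.1 \in A) && (p.2 \notin M |: p.1)].
  pose PB := [set p : {set 'I_m} * 'I_m | (p.1 \in B) && (p.2 \in p.1)].
  have cA : #|PA| = (#|A| * (m.-1 - k))%N.
    rewrite -sum1_card (eq_bigl (fun p => (p.1 \in A) && (p.2 \notin M |: p.1))).
      rewrite -(pair_big_dep (fun S => S \in A) (fun S j => j \notin M |: S) (fun _ _ => 1%N)) /=.
      rewrite -sum_nat_const; apply: eq_bigr => S; rewrite !inE => /andP[/andP[MS /eqP Sk] _].
      rewrite sum1_card; transitivity #|~: (M |: S)|.
        by apply: eq_card => j; rewrite !inE unfold_in !inE.
      by rewrite cardsCs setCK cardsU1 MS Sk card_ord -subn1 subnDA.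
    by move=> p; rewrite inE.
  have cB : #|PB| = (#|B| * k.+1)%N.
    rewrite -sum1_card (eq_bigl (fun p => (p.1 \in B) && (p.2 \in p.1))).
      rewrite -(pair_big_dep (fun S => S \in B) (fun S j => j \in S) (fun _ _ => 1%N)) /=.
      rewrite -sum_nat_const; apply: eq_bigr => S; rewrite !inE => /andP[/andP[MS /eqP Sk] _].
      by rewrite sum1_card -Sk.
    by move=> p; rewrite inE.
  rewrite -cA -cB.
  have inj : {in PA &, injective (fun p : {set 'I_m} * 'I_m => (p.2 |: p.1, p.2))}.
    move=> [S j] [S' j']; rewrite !inE /= !negb_or => /andP[_ /andP[_ jS]] /andP[_ /andP[_ jS']].
    case=> h jj; rewrite jj in jS h *; congr pair; apply/setP => i; move/setP/(_ i): h; rewrite !inE.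
    by have [->|//] := eqVneq i j'; rewrite (negbTE jS) (negbTE jS').
  rewrite -(card_in_imset inj) subset_leq_card //; apply/subsetP => _ /imsetP[[S j] + ->].
  rewrite !inE /= negb_or => /andP[/andP[/andP[MS /eqP Sk] QS] /andP[jM jS]].
  rewrite eqxx orTb andbT negb_or eq_sym jM MS /= cardsU1 jS Sk eqxx /=.
  by apply: hQ => //; rewrite inE MS Sk eqxx.
rewrite /freq -/A -/B ler_pdivrMr ?bin_gt0 // mulrAC ler_pdivlMr ?bin_gt0 // -!natrM ler_nat.
have km1 : (k < m.-1)%N by rewrite -ltnS prednK.
have h := mul_bin_left m.-1 k.
rewrite -(leq_pmul2r (_ : 0 < k.+1)%N) // -mulnA (mulnC 'C(_, _)) h.
by rewrite mulnA [leqRHS]mulnAC leq_mul2r cnt orbT.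
Qed.

(** The Shapley coefficient at size k is [1 / (m * 'C(m - 1, k))]. Counting losing instead of
    winning coalitions reverses the difference. *)
Lemma shapley_value_freq (w : 'I_m -> R) gamma :
  shapley_value w gamma M =
  \sum_(k < m) (freq (fun S => \sum_(j in S) w j < gamma) k -
                freq (fun S => \sum_(j in M |: S) w j < gamma) k) / m%:R.
Proof.
have split_card (f : {set 'I_m} -> R) :
    \sum_(S : {set 'I_m} | M \notin S) f S = \sum_(k < m) \sum_(S in rivals k) f S.
  transitivity (\sum_(S : {set 'I_m} | M \notin S) \sum_(k < m | #|S| == k) f S).
    apply: eq_bigr => S MS; have Sm : (#|S| < m)%N.
      rewrite -[X in (_ < X)%N](card_ord m) -cardsT proper_card // properE subsetT.
      by apply/subsetPn; exists M.
    by rewrite (big_pred1 (Ordinal Sm)) // => k; rewrite eq_sym -val_eqE.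
  rewrite (exchange_big_dep xpredT) //=; apply: eq_bigr => k _.
  by apply: eq_bigl => S; rewrite inE.
have game T : ensemble_game w gamma T = 1 - (\sum_(j in T) w j < gamma)%R%:R.
  by rewrite /ensemble_game ltNge; case: leP => _; rewrite ?subrr ?subr0.
have count Q k : \sum_(S in rivals k) (Q S)%:R = #|[set S in rivals k | Q S]|%:R :> R.
  rewrite -natr_sum -sum1_card; congr _%:R.
  under [RHS]eq_bigl => S do rewrite inE.
  by rewrite [RHS]big_mkcondr /=; apply: eq_bigr => S _; case: (Q S).
rewrite /shapley_value split_card; apply: eq_bigr => k _.
have km1 : (k <= m.-1)%N by rewrite -ltnS prednK.
rewrite /freq -mulrBl -!count -sumrB -mulrA mulr_suml; apply: eq_bigr => S.
rewrite inE => /andP[_ /eqP ->]; rewrite !game mulrC; congr (_ * _); first by ring.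
have fE : (m`! = m * ('C(m.-1, k) * (k`! * (m.-1 - k)`!)))%N.
  by rewrite bin_fact // -{1 2}(prednK m_gt0) factS.
rewrite fE subnAC subn1; set X := (k`! * _)%N.
have X0 : X%:R != 0 :> R by rewrite pnatr_eq0 -lt0n muln_gt0 !fact_gt0.
clearbody X.
have C0 : 'C(m.-1, k)%:R != 0 :> R by rewrite gt_eqF // bin_gt0.
have m0 : m%:R != 0 :> R by rewrite pnatr_eq0 -lt0n.
by rewrite !natrM; field; apply/and3P; split.
Qed.
End CoalitionFrequency.

Section PivotFrequency.
Context {R : realType} {m : nat}.
Variables (w : 'I_m -> R) (gamma : R) (M : 'I_m).
Hypothesis w_ge0 : forall j, 0 <= w j.
Hypothesis gamma_gt0 : 0 < gamma.
Hypothesis gamma_le : gamma <= \sum_j w j.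

Let weight (S : {set 'I_m}) := \sum_(j in S) w j.
Let loses : pred {set 'I_m} := fun S => weight S < gamma.
Let loses_with : pred {set 'I_m} := fun S => weight (M |: S) < gamma.

(** For nonnegative weights, losing with [M] implies losing without it, so this is the frequency
    with which [M] is pivotal at size k. *)
Definition pivot_freq k : R :=
  freq M (fun S => \sum_(j in S) w j < gamma) k -
  freq M (fun S => \sum_(j in M |: S) w j < gamma) k.

Let pivotE k : pivot_freq k = freq M loses k - freq M loses_with k.
Proof. by []. Qed.

Let m_gt0 : (0 < m)%N. Proof. by case: m M => [[]|]. Qed.

Let weightU1 (S : {set _}) : M \notin S -> weight (M |: S) = w M + weight S.
Proof. by move=> MS; rewrite /weight big_setU1. Qed.

Let weightC (S : {set _}) : weight S + weight (~: S) = \sum_j w j.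
Proof.
rewrite /weight [RHS](bigID (mem S)) /=; congr (_ + _).
by apply: eq_bigl => j; rewrite inE.
Qed.

Let weight_ge0 S : 0 <= weight S. Proof. by apply: sumr_ge0. Qed.

Let weight_le (S : {set _}) : M \notin S -> weight S <= \sum_j w j - w M.
Proof.
move=> MS; have := weightC (M |: S); rewrite weightU1 //.
by have := weight_ge0 (~: (M |: S)); lra.
Qed.

Lemma pivot_freq_ge0 k : 0 <= pivot_freq k.
Proof.
rewrite pivotE subr_ge0; apply: le_freq => S; rewrite inE => /andP[MS _].
rewrite /loses_with /loses weightU1 // => h; have := w_ge0 M; lra.
Qed.

Lemma pivot_freq_le1 k : (k < m)%N -> pivot_freq k <= 1.
Proof.
move=> km; rewrite pivotE.
by have := @freq_le1 R _ M loses _ km; have := @freq_ge0 R _ M loses_with k; lra.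
Qed.

Let in_rivals0 (S : {set _}) : S \in rivals M 0 -> S = set0.
Proof. by rewrite inE cards_eq0 => /andP[_ /eqP]. Qed.

Lemma pivot_freq0 : pivot_freq 0 = (gamma <= w M)%R%:R.
Proof.
rewrite pivotE (@freq_eq1 _ _ M loses) //; last first.
  by move=> S /in_rivals0 ->; rewrite /loses /weight big_set0.
case: (leP gamma (w M)) => h.
  rewrite freq_eq0 ?subr0 // => S /in_rivals0 ->.
  by rewrite /loses_with weightU1 ?inE // /weight big_set0 addr0 -leNgt.
rewrite freq_eq1 ?subrr // => S /in_rivals0 ->.
by rewrite /loses_with weightU1 ?inE // /weight big_set0 addr0.
Qed.

Let loses_with_last : freq M loses_with m.-1 = 0 :> R.
Proof.
apply: freq_eq0 => S; rewrite inE => /andP[MS /eqP Sm]; rewrite /loses_with -leNgt.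
rewrite (_ : M |: S = setT) ?/weight; last first.
  by apply/eqP; rewrite eqEcard subsetT cardsT card_ord cardsU1 MS Sm add1n prednK ?leqnn.
by rewrite (eq_bigl xpredT) // => j; rewrite inE.
Qed.

Let sum_nat0 (f : nat -> R) : \sum_(1 <= k < m) f k = \sum_(0 <= k < m) f k - f 0.
Proof. by rewrite [in RHS]big_ltn //; lra. Qed.

(** All rivals together lose, so the term of size m - 1 alone equals 1. *)
Lemma sum_pivot_veto : (1 < m)%N -> \sum_j w j - w M < gamma ->
  1 <= \sum_(1 <= k < m) pivot_freq k.
Proof.
move=> m1 veto; have e : pivot_freq m.-1 = 1.
  rewrite pivotE loses_with_last subr0 freq_eq1 // ?prednK // => S.
  by rewrite inE => /andP[MS _]; rewrite /loses; apply: le_lt_trans (weight_le MS) veto.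
rewrite -(prednK m_gt0) big_nat_recr /=; last by rewrite -ltnS prednK.
by rewrite e lerDr sumr_ge0 // => k _; exact: pivot_freq_ge0.
Qed.

(* Rivals no heavier than M cannot carry the running weight of an ordering of
   the players across the window [gamma - w M, gamma) in one step. *)
Lemma sum_pivot_heaviest : (forall j, j != M -> w j <= w M) -> w M < gamma ->
  1 <= \sum_(1 <= k < m) pivot_freq k.
Proof.
move=> heavy Mg; rewrite sum_nat0 pivot_freq0 (_ : gamma <= w M = false) ?subr0; last by rewrite leNgt Mg.
have step k : (k.+1 < m)%N -> freq M loses_with k <= freq M loses k.+1 :> R.
  move=> km; apply: freq_step => // S j; rewrite inE => /andP[MS _].
  rewrite /loses_with /loses weightU1 // => h jS jM.
  by rewrite /weight big_setU1 //=; have := heavy j jM; rewrite -/(weight S); lra.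
(* By [step] the sum telescopes from the losing frequency 1 at size 0; [loses_with] never holds at
   size m - 1, where the remainder vanishes. *)
have tel n : (n < m)%N ->
    1 <= \sum_(0 <= k < n.+1) pivot_freq k + freq M loses_with n.
  elim: n => [|n IH] nm.
    rewrite big_nat1 pivotE freq_eq1 ?subrK //.
    by move=> S /in_rivals0 ->; rewrite /loses /weight big_set0.
  have := IH (ltnW nm); rewrite [in X in _ -> X]big_nat_recr //= pivotE.
  by have := step n nm; lra.
by have := tel m.-1; rewrite loses_with_last addr0 prednK //; apply.
Qed.

Let alone k : gamma <= w M -> pivot_freq k = freq M loses k.
Proof.
move=> gM; rewrite pivotE (@freq_eq0 _ _ M loses_with) ?subr0 // => S; rewrite inE => /andP[MS _].
by rewrite /loses_with -leNgt weightU1 //; have := weight_ge0 S; lra.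
Qed.

Lemma pivot_freq_dictator k : (k < m)%N -> gamma <= w M ->
  \sum_j w j - w M < gamma -> pivot_freq k = 1.
Proof.
move=> km gM h; rewrite alone // freq_eq1 // => S; rewrite inE => /andP[MS _].
exact: le_lt_trans (weight_le MS) h.
Qed.

(* Of two complementary coalitions of rivals at least one stays below gamma. *)
Lemma sum_pivot_alone : gamma <= w M -> \sum_j w j - w M < 2 * gamma ->
  m%:R / 2 - 1 <= \sum_(1 <= k < m) pivot_freq k.
Proof.
move=> gM h; rewrite sum_nat0 pivot_freq0 gM lerD2r.
have pair k : (k < m)%N -> 1 <= pivot_freq k + pivot_freq (m.-1 - k).
  move=> km; rewrite !alone //; apply: freq_compl => // S; rewrite inE => /andP[MS _].
  rewrite /loses -leNgt; have := weightC (M |: S); rewrite weightU1 //; lra.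
suff : m%:R <= \sum_(0 <= k < m) pivot_freq k + \sum_(0 <= k < m) pivot_freq k by lra.
rewrite {2}big_nat_rev -big_split /= !big_mkord -[m in leLHS]card_ord -sumr_const.
apply: ler_sum => k _; rewrite add0n (_ : (m - k.+1)%N = (m.-1 - k)%N) ?pair //.
by rewrite -subn1 -subnDA add1n.
Qed.
End PivotFrequency.

From mathcomp Require Import all_classical all_reals all_analysis measurable_realfun.
Import numFieldNormedType.Exports.

(** * Gaussian estimates *)

Section Elementary.
Local Open Scope classical_set_scope.
Context {R : realType}.

Lemma derive_ge0_le (f df : R -> R) (a : R) :
  (forall x : R, is_derive x (1 : R) f (df x)) -> (forall x, a <= x -> 0 <= df x) ->
  forall x, a <= x -> f a <= f x.
Proof.
move=> Df df0 x ax.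
have cf : {within `[a, x], continuous f}.
  by apply: derivable_within_continuous => z _; have [] := Df z.
have [c /itvP ac /eqP] := MVT_segment ax (fun z _ => Df z) cf.
rewrite subr_eq => /eqP ->; rewrite lerDr mulr_ge0 ?subr_ge0 // df0 //.
by rewrite ac.
Qed.

(** Start of a chain of Taylor bounds: each difference vanishes at 0, and its derivative is
    nonnegative by the preceding bound. *)
Lemma sin_le_id (x : R) : 0 <= x -> sin x <= x.
Proof.
move=> x0; pose f (z : R) := z - sin z.
have Df z : is_derive z (1 : R) f (1 - cos z) by exact: is_deriveB.
have := derive_ge0_le Df (a := 0) _ x0; rewrite /f sin0 subrr subr_ge0; apply.
by move=> z _; rewrite subr_ge0 cos_le1.
Qed.

Lemma cos_ge_poly2 (x : R) : 0 <= x -> 1 - x ^+ 2 / 2 <= cos x.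
Proof.
move=> x0; pose f (z : R) := cos z - (1 - z ^+ 2 / 2).
have Df (z : R) : is_derive z (1 : R) f (z - sin z).
  by apply: is_derive_eq; rewrite /GRing.scale /=; field.
have := derive_ge0_le Df (a := 0) _ x0; rewrite /f cos0 !expr0n /=.
have h (z : R) : 0 <= z -> 0 <= z - sin z by move=> z0; have := sin_le_id z0; lra.
by move=> /(_ h); lra.
Qed.

Lemma sin_ge_poly3 (x : R) : 0 <= x -> x - x ^+ 3 / 6 <= sin x.
Proof.
move=> x0; pose f (z : R) := sin z - (z - z ^+ 3 / 6).
have Df (z : R) : is_derive z (1 : R) f (cos z - (1 - z ^+ 2 / 2)).
  by apply: is_derive_eq; rewrite /GRing.scale /=; field.
have := derive_ge0_le Df (a := 0) _ x0; rewrite /f sin0 !expr0n /=.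
have h (z : R) : 0 <= z -> 0 <= cos z - (1 - z ^+ 2 / 2) by move=> z0; have := cos_ge_poly2 z0; lra.
by move=> /(_ h); lra.
Qed.

Lemma cos_le_poly4 (x : R) : 0 <= x -> cos x <= 1 - x ^+ 2 / 2 + x ^+ 4 / 24.
Proof.
move=> x0; pose f (z : R) := (1 - z ^+ 2 / 2 + z ^+ 4 / 24) - cos z.
have Df (z : R) : is_derive z (1 : R) f (sin z - (z - z ^+ 3 / 6)).
  by apply: is_derive_eq; rewrite /GRing.scale /=; field.
have := derive_ge0_le Df (a := 0) _ x0; rewrite /f cos0 !expr0n /=.
have h (z : R) : 0 <= z -> 0 <= sin z - (z - z ^+ 3 / 6) by move=> z0; have := sin_ge_poly3 z0; lra.
by move=> /(_ h); lra.
Qed.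

Lemma sin_le_poly5 (x : R) : 0 <= x -> sin x <= x - x ^+ 3 / 6 + x ^+ 5 / 120.
Proof.
move=> x0; pose f (z : R) := (z - z ^+ 3 / 6 + z ^+ 5 / 120) - sin z.
have Df (z : R) : is_derive z (1 : R) f ((1 - z ^+ 2 / 2 + z ^+ 4 / 24) - cos z).
  by apply: is_derive_eq; rewrite /GRing.scale /=; field.
have := derive_ge0_le Df (a := 0) _ x0; rewrite /f sin0 !expr0n /=.
have h (z : R) : 0 <= z -> 0 <= (1 - z ^+ 2 / 2 + z ^+ 4 / 24) - cos z.
  by move=> z0; have := cos_le_poly4 z0; lra.
by move=> /(_ h); lra.
Qed.

Lemma expRN_le_poly2 (x : R) : 0 <= x -> expR (- x) <= 1 - x + x ^+ 2 / 2.
Proof.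
move=> x0; pose f (z : R) := (1 - z + z ^+ 2 / 2) - expR (- z).
have Df (z : R) : is_derive z (1 : R) f (expR (- z) - (1 - z)).
  by apply: is_derive_eq; rewrite /GRing.scale /=; field.
have := derive_ge0_le Df (a := 0) _ x0; rewrite /f oppr0 expR0 !expr0n /=.
have h (z : R) : 0 <= z -> 0 <= expR (- z) - (1 - z).
  by move=> z0; rewrite subr_ge0 expR_ge1Dx.
by move=> /(_ h); lra.
Qed.

(** If [pi <= 314 / 100], then [x = pi / 4 <= 157 / 200], and the quintic bound keeps [sin x] below
    707/1000, whose square is less than 1/2. *)
Lemma pi_gt : 314 / 100 < pi :> R.
Proof.
rewrite ltNge; apply/negP => hpi; have p2 := pi_ge2 R.
pose x : R := pi / 4; have x0 : 1 / 2 <= x by rewrite /x; lra.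
have s2 : sin x ^+ 2 = 1 / 2.
  have := cosD x x; rewrite -mulr2n (_ : x *+ 2 = pi / 2); last by rewrite /x; field.
  by rewrite cos_pihalf; have := cos2Dsin2 x; nra.
have s0 : 0 <= sin x by apply: sin_ge0_pi; rewrite /x; lra.
have sx : sin x <= x - x ^+ 3 / 6 + x ^+ 5 / 120 by apply: sin_le_poly5; lra.
have xc : x <= 157 / 200 by rewrite /x; lra.
have x5 : x ^+ 5 <= (157 / 200) ^+ 5 by rewrite ler_pXn2r ?nnegrE //; lra.
(* Factored increase of [z - z ^ 3 / 6] from [x] to 157/200. *)
have x3 : 0 <= (157 / 200 - x) * (1 - ((157 / 200) ^+ 2 + 157 / 200 * x + x ^+ 2) / 6).
  by apply: mulr_ge0; [lra|nra].
have : sin x <= 707 / 1000 by lra.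
by nra.
Qed.

(** The quartic upper bound on the cosine is negative between 8/5 and 2, whereas
    [cos (pi / 2) = 0]. *)
Lemma pi_lt : pi < 32 / 10 :> R.
Proof.
have [p1 p2] : 1 <= pi / 2 :> R /\ pi / 2 < 2 :> R by split; [exact: pihalf_ge1|exact: pihalf_lt2].
rewrite ltNge; apply/negP => hpi.
have := @cos_le_poly4 (pi / 2) ltac:(lra); rewrite cos_pihalf.
set u := pi / 2 in p1 p2 *; have hu : 16 / 10 <= u by rewrite /u; lra.
have u1 : 256 / 100 <= u ^+ 2 by nra.
have u2 : u ^+ 2 <= 4 by nra.
rewrite (_ : u ^+ 4 = (u ^+ 2) ^+ 2); last by ring.
by move: (u ^+ 2) u1 u2 => v v1 v2; nra.
Qed.
End Elementary.

Section NormalCdf.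
Local Open Scope classical_set_scope.
Context {R : realType}.
Notation mu := (@lebesgue_measure R).

Definition Phi (y : R) : R := fine (normal_prob 0 1 `]-oo, y]).

Let pdf_scale (c s x : R) : 0 < s ->
  normal_pdf c s x = normal_pdf 0 1 ((x - c) / s) * s^-1.
Proof.
move=> s0; rewrite !normal_pdfE ?gt_eqF // /normal_peak /normal_fun.
rewrite subr0 expr1n mul1r [RHS]mulrAC; congr (_ * _).
  rewrite -mulrnAr sqrtrM ?sqr_ge0 // sqrtr_sqr gtr0_norm // invfM mulrC.
  by rewrite mulrC.
by congr expR; field; rewrite gt_eqF.
Qed.

Lemma normal_prob_Ny (c s b : R) : 0 < s ->
  normal_prob c s `]-oo, b] = normal_prob 0 1 `]-oo, (b - c) / s].
Proof.
move=> s0; rewrite /normal_prob.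
pose F (x : R) := (x - c) / s.
have DF (x : R) : is_derive x (1 : R) F s^-1.
  by apply: is_derive_eq; rewrite /GRing.scale /=; field; rewrite gt_eqF.
have F'E : F^`()%classic = cst s^-1.
  by apply/funext => x; rewrite derive1E; exact: derive_val.
have s'0 : 0 < s^-1 by rewrite invr_gt0.
rewrite -/(F b) (@increasing_ge0_integration_by_substitutionNy _ F (normal_pdf 0 1)).
- by apply: eq_integral => x _; rewrite F'E; congr EFin; exact: pdf_scale.
- by move=> x y _ _ xy; rewrite /F ltr_pM2r // ltrD2r.
- by rewrite F'E => x _; exact: cvg_cst.
- by rewrite F'E; exact: is_cvg_cst.
- by rewrite F'E; exact: cvg_cst.
- split.
    by move=> x _; have [] := DF x.
  apply: cvg_at_left_filter; apply: differentiable_continuous.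
  by apply/derivable1_diffP; have [] := DF b.
- apply/gt0_cvgMlNy => //; exact: cvg_addrr_Ny.
- by apply: continuous_subspaceT; apply: continuous_normal_pdf.
- by move=> x _; exact: normal_pdf_ge0.
Qed.

Let fin_normal (c s : R) (A : set R) : measurable A -> normal_prob c s A \is a fin_num.
Proof. by move=> mA; exact: fin_num_measure. Qed.

Lemma normal_prob_co (c s a b : R) : 0 < s -> a <= b ->
  fine (normal_prob c s `[a, b[) = Phi ((b - c) / s) - Phi ((a - c) / s).
Proof.
move=> s0 ab; rewrite /Phi -!normal_prob_Ny //.
have -> : normal_prob c s `[a, b[ = normal_prob c s `]a, b].
  rewrite /normal_prob (@integral_itv_bndoo R a b _ true true).
    rewrite (@integral_itv_bndoo R a b _ false false) //.
    by apply/measurable_EFinP/measurable_funTS; exact: measurable_normal_pdf.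
  by apply/measurable_EFinP/measurable_funTS; exact: measurable_normal_pdf.
have -> : normal_prob c s `]-oo, b] = (normal_prob c s `]-oo, a] + normal_prob c s `]a, b])%E.
  rewrite -measureU //; last first.
    by apply/seteqP; split => // x /=; rewrite !in_itv /= => -[xa /andP[/lt_le_trans/(_ xa)]]; rewrite ltxx.
  congr (normal_prob c s); apply/seteqP; split => x /=; rewrite !in_itv /=.
    by case: (leP x a) => [?|? ->]; [left|right].
  by case=> [/le_trans|/andP[]]; [apply|].
have fa := @fin_normal c s `]-oo, a] (measurable_itv _).
have fab := @fin_normal c s `]a, b] (measurable_itv _).
move: (normal_prob c s `]-oo, a]) (normal_prob c s `]a, b]) fa fab => u v fu fv.
by rewrite fineD // addrAC subrr add0r.
Qed.

Lemma Phi_le (x y : R) : x <= y -> Phi x <= Phi y.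
Proof.
move=> xy; rewrite fine_le ?fin_normal // le_measure ?inE //.
by move=> z /=; rewrite !in_itv /= => /le_trans; apply.
Qed.

Lemma Phi_ge0 (x : R) : 0 <= Phi x. Proof. exact: fine_ge0. Qed.

Lemma PhiN (x : R) : Phi (- x) = 1 - Phi x.
Proof.
have e : normal_prob 0 1 `]-oo, - x] = normal_prob 0 1 `]x, +oo[ :> \bar R.
  rewrite /normal_prob ge0_integration_by_substitutionNy.
  - rewrite integral_itv_obnd_cbnd; last first.
      by apply/measurable_EFinP/measurable_funTS; exact: measurable_normal_pdf.
    apply: eq_integral => z _; congr EFin => /=.
    by rewrite !normal_pdfE ?oner_eq0 // /normal_fun !subr0 sqrrN.
  - by apply: continuous_subspaceT; apply: continuous_normal_pdf.
  - by move=> z _; exact: normal_pdf_ge0.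
have h : (normal_prob 0 1 `]-oo, x] + normal_prob 0 1 `]x, +oo[ = 1 :> \bar R)%E.
  rewrite -measureU //; last first.
    by apply/seteqP; split => // z /=; rewrite !in_itv /= andbT => -[/le_lt_trans zx /zx]; rewrite ltxx.
  rewrite (_ : _ `|` _ = setT); first exact: integral_normal_pdf.
  by apply/seteqP; split => // z _ /=; rewrite !in_itv /= andbT; case: (leP z x); [left|right].
have := congr1 fine h; rewrite /Phi e.
have fa := @fin_normal 0 1 `]-oo, x] (measurable_itv _).
have fab := @fin_normal 0 1 `]x, +oo[ (measurable_itv _).
move: (normal_prob 0 1 `]-oo, x]) (normal_prob 0 1 `]x, +oo[) fa fab => u v fu fv.
by rewrite fineD //= => <-; rewrite addrAC subrr add0r.
Qed.

Lemma Phi_half (x : R) : x <= 0 -> Phi x <= 1 / 2.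
Proof. by move=> /Phi_le h; have := PhiN 0; rewrite oppr0; lra. Qed.

Lemma Phi_le1 (x : R) : Phi x <= 1.
Proof. by have := PhiN x; have := Phi_ge0 (- x); lra. Qed.
End NormalCdf.

Section Tangent.
Local Open Scope classical_set_scope.
Context {R : realType}.
Notation mu := (@lebesgue_measure R).

(* Majorant of the standard normal density minus 29 / 100 on [-4 / 5, 4 / 5], outside of
   which the density is below 29 / 100; 200 / 501 exceeds 1 / sqrt (2 pi) and the
   polynomial is [expRN_le_poly2]. *)
Let hump (z : R) : R := 200 / 501 * (1 - z ^+ 2 / 2 + z ^+ 4 / 8) - 29 / 100.
Let hump_prim (z : R) : R := 200 / 501 * (z - z ^+ 3 / 6 + z ^+ 5 / 40) - 29 / 100 * z.

Let Dhump (z : R) : is_derive z (1 : R) hump_prim (hump z).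
Proof. by apply: is_derive_eq; rewrite /hump /GRing.scale /=; field. Qed.

Let Dhump' (z : R) : derivable hump z 1.
Proof. by apply: ex_derive. Qed.

Let peak_le : normal_peak (1 : R) <= 200 / 501.
Proof.
have h : (501 / 200) ^+ 2 <= pi *+ 2 :> R by have := @pi_gt R; lra.
rewrite /normal_peak expr1n mul1r invf_ple ?posrE ?sqrtr_gt0; last 2 first.
- by rewrite mulrn_wgt0 // pi_gt0.
- by lra.
rewrite invf_div -(@ger0_norm _ (501 / 200)); last by lra.
by rewrite -sqrtr_sqr ler_wsqrtr.
Qed.

Let pdfE (z : R) : normal_pdf 0 1 z = normal_peak 1 * expR (- (z ^+ 2 / 2)).
Proof. by rewrite normal_pdfE ?oner_eq0 // /normal_fun subr0 expr1n mulNr. Qed.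

Let pdf_le_hump (z : R) : normal_pdf 0 1 z <= 29 / 100 + hump z.
Proof.
have z0 : 0 <= z ^+ 2 / 2 by rewrite divr_ge0 // sqr_ge0.
have h := expRN_le_poly2 z0; rewrite pdfE /hump.
have := ler_pM (normal_peak_ge0 _) (expR_ge0 _) peak_le h; lra.
Qed.

Let pow4 (a b : R) : 0 <= a -> a <= b -> a ^+ 4 <= b ^+ 4.
Proof. by move=> a0 ab; rewrite lerXn2r // nnegrE (le_trans a0). Qed.

Let pdf_le_far (z : R) : 4 / 5 <= `|z| -> normal_pdf 0 1 z <= 29 / 100.
Proof.
move=> hz; rewrite pdfE.
(* The exponent 8/25 is cut into four parts of 2/25: the quadratic bound applied at 8/25 directly
   would miss 29/100. *)
have h1 : expR (- (z ^+ 2 / 2)) <= expR (- (2 / 25)) ^+ 4.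
  rewrite -expRM_natl ler_expR -real_normK ?num_real //.
  have : (4 / 5) ^+ 2 <= `|z| ^+ 2 by rewrite ler_pXn2r ?nnegrE //; lra.
  lra.
have h2 : expR (- (2 / 25)) <= 577 / 625 :> R.
  by have := @expRN_le_poly2 R (2 / 25) ltac:(lra); lra.
have h3 : expR (- (2 / 25)) ^+ 4 <= (577 / 625) ^+ 4 :> R.
  by move: (expR_ge0 (- (2 / 25) : R)) h2; exact: pow4.
have := ler_pM (normal_peak_ge0 _) (expR_ge0 _) peak_le (le_trans h1 h3); lra.
Qed.

Let hump_ge0 (z : R) : `|z| <= 4 / 5 -> 0 <= hump z.
Proof.
move=> hz; have : `|z| ^+ 2 <= (4 / 5) ^+ 2 by rewrite ler_pXn2r ?nnegrE //; lra.
by rewrite real_normK ?num_real // /hump => h; have := sqr_ge0 (z ^+ 2 - 16 / 25); nra.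
Qed.

Let D : set R := `[- (4 / 5), 4 / 5]%classic.

Let int_hump : (\int[mu]_(z in D) (hump z)%:E <= (114 / 1000)%:E)%E.
Proof.
have chump : continuous hump.
  by move=> z; apply/differentiable_continuous/derivable1_diffP.
rewrite (@continuous_FTC2 R hump hump_prim (- (4 / 5)) (4 / 5)).
- by rewrite -EFinB lee_fin /hump_prim; lra.
- by lra.
- exact: continuous_subspaceT.
- have cprim : continuous hump_prim.
    by move=> z; apply/differentiable_continuous/derivable1_diffP; apply: ex_derive.
  split; first by move=> z _; apply: ex_derive.
    by apply: cvg_at_right_filter; exact: cprim.
  by apply: cvg_at_left_filter; exact: cprim.
- by move=> z _; rewrite derive1E; exact: derive_val.
Qed.

(** The density is at most 29/100 plus a hump whose integral is at most 114/1000. The constant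
    386/1000 of [we_flat] is 1/2 - 114/1000. *)
Lemma Phi_lipschitz_offset (x y : R) : x <= y ->
  Phi y - Phi x <= 29 / 100 * (y - x) + 114 / 1000.
Proof.
move=> xy; have := @normal_prob_co R 0 1 x y ltr01 xy.
rewrite !subr0 !divr1 => <-.
pose r (z : R) : R := (hump \_ D) z.
have r0 z : 0 <= r z.
  rewrite /r patchE; case: ifPn => // /set_mem; rewrite /D /= in_itv /= => hz.
  by apply: hump_ge0; rewrite ler_norml.
have mr : measurable_fun setT r.
  apply/(measurable_restrictT _ _).1; first exact: measurable_itv.
  apply: measurable_funTS; apply: continuous_measurable_fun => z.
  by apply/differentiable_continuous/derivable1_diffP.
have le_r z : normal_pdf 0 1 z <= 29 / 100 + r z.
  rewrite /r patchE; case: ifPn => [_|]; first exact: pdf_le_hump.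
  rewrite notin_setE /D /= in_itv /= => /negP; rewrite -ler_norml -ltNge addr0 => /ltW.
  exact: pdf_le_far.
rewrite -lee_fin fineK; last exact: fin_num_measure.
rewrite /normal_prob.
apply: (@le_trans _ _ (\int[mu]_(z in `[x, y[) ((29 / 100)%:E + (r z)%:E))%E).
  apply: ge0_le_integral => //.
  - by move=> z _; rewrite lee_fin normal_pdf_ge0.
  - by apply/measurable_EFinP/measurable_funTS; exact: measurable_normal_pdf.
  - by apply: emeasurable_funD => //; apply/measurable_EFinP/measurable_funTS.
  - by move=> z _; rewrite -EFinD lee_fin.
have mr' : measurable_fun `[x, y[ (fun z => (r z)%:E).
  by apply/measurable_EFinP/measurable_funTS.
rewrite ge0_integralD //=; last by move=> z _; rewrite lee_fin.
rewrite (integral_cst mu (measurable_itv _) (29 / 100)%:E) /= lebesgue_measure_itv /= lte_fin.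
rewrite EFinD leeD //.
  by case: ltP => _; rewrite -?EFinD -?EFinM lee_fin; nra.
apply: le_trans int_hump; rewrite [leRHS]integral_mkcond.
apply: (@le_trans _ _ (\int[mu]_z (r z)%:E)%E).
  apply: ge0_subset_integral => //; first by apply/measurable_EFinP.
  by move=> z _; rewrite lee_fin.
by rewrite le_eqVlt; apply/orP; left; apply/eqP; apply: eq_integral => z _;
   rewrite /r !patchE; case: ifP.
Qed.
End Tangent.

(** * Window properties of the normal approximation *)

Section Windows.
Context {R : realType}.
Variables (t g : R) (F : nat -> R).
Hypotheses (t_ge0 : 0 <= t) (g_gt0 : 0 < g).

(** The degenerate distribution: [F k] is 1/2 or -1/2, so a pairing property only has to exclude
    that both sizes are pivotal. The premise [1 < t] of [we_flat] contradicts [t <= 1]. *)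
Lemma point_window_excess (T2 : R) : t <= 1 ->
  (forall k, (0 < k)%N -> F k = ((g - t <= k%:R) && (k%:R < g))%R%:R - 1 / 2) ->
  (forall k, F k <= 1 / 2) ->
  window_excess t g T2 F.
Proof.
move=> t1 FE Fh.
have out k : (0 < k)%N -> ~~ ((g - t <= k%:R) && (k%:R < g)) -> F k = - (1 / 2).
  by move=> k0 /negbTE h; rewrite FE // h mulr0n sub0r.
have le0 k : (0 < k)%N -> ~~ ((g - t <= k%:R) && (k%:R < g)) -> F k <= 0.
  by move=> k0 h; rewrite out //; lra.
have pair j k : (0 < j)%N -> (0 < k)%N ->
    ~~ [&& g - t <= j%:R, j%:R < g, g - t <= k%:R & k%:R < g] -> F j + F k <= 0.
  move=> j0 k0; rewrite andbA negb_and => /orP[h|h].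
    by rewrite (out j) //; have := Fh k; lra.
  by rewrite (out k) //; have := Fh j; lra.
split => //.
- by move=> k k0 h; apply: le0 => //; apply/negP => /andP[]; lra.
- by move=> k k0 h; apply: le0 => //; apply/negP => /andP[]; lra.
- move=> j k j0 k0 h; apply: pair => //; apply/negP => /and4P[_ hj _ hk].
  have : j%:R * k%:R < g * g by apply: ltr_pM.
  by rewrite -expr2; lra.
- by move=> j k j0 k0 h1 h2; apply: pair => //; apply/negP => /and4P[]; lra.
- by move=> j k rho j0 k0 h _ _ _; apply: pair => //; apply/negP => /and4P[]; lra.
- by move=> k eta; lra.
Qed.

Let reflected (a b c d : R) : a <= 1 - c -> 0 <= b -> 0 <= d ->
  a - b - 1 / 2 + (c - d - 1 / 2) <= 0.
Proof. lra. Qed.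

Let disjoint (a b c d : R) : c <= b -> a <= 1 -> 0 <= d ->
  a - b - 1 / 2 + (c - d - 1 / 2) <= 0.
Proof. lra. Qed.

Lemma normal_window_excess (s : R) : 0 < s ->
  (forall k, (0 < k)%N -> F k = Phi ((g - k%:R) * s / Num.sqrt k%:R) -
     Phi ((g - t - k%:R) * s / Num.sqrt k%:R) - 1 / 2) ->
  (forall k, F k <= 1 / 2) ->
  window_excess t g ((t * s) ^+ 2) F.
Proof.
move=> s0 FE Fh.
have sq k : (0 < k)%N -> 0 < Num.sqrt k%:R :> R /\ Num.sqrt k%:R ^+ 2 = k%:R :> R.
  by move=> k0; rewrite sqrtr_gt0 ltr0n sqr_sqrtr.
split => //.
- move=> k k0 h; rewrite FE //; have [q0 qE] := sq k k0.
  set x := (g - t - k%:R) * s / _; have x0 : 0 <= x.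
    by rewrite divr_ge0 ?(ltW q0) // mulr_ge0 ?(ltW s0) //; lra.
  have := Phi_le1 ((g - k%:R) * s / Num.sqrt k%:R).
  by have := @Phi_half _ (- x); rewrite PhiN oppr_le0 => /(_ x0); lra.
- move=> k k0 h; rewrite FE //; have [q0 qE] := sq k k0.
  have := Phi_ge0 ((g - t - k%:R) * s / Num.sqrt k%:R).
  have : (g - k%:R) * s / Num.sqrt k%:R <= 0.
    by rewrite pmulr_lle0 ?invr_gt0 // pmulr_lle0 // subr_le0.
  by move=> /Phi_half; lra.
- move=> j k j0 k0 h; rewrite !FE //; have [p0 pE] := sq j j0; have [q0 qE] := sq k k0.
  set p := Num.sqrt j%:R in p0 pE *; set q := Num.sqrt k%:R in q0 qE *.
  have gpq : g <= p * q.
    rewrite -(@ler_pXn2r _ 2) ?nnegrE ?mulr_ge0 // ?(ltW p0) ?(ltW q0) ?(ltW g_gt0) //.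
    by rewrite exprMn pE qE.
  (* After clearing denominators, with [j = p ^ 2] and [k = q ^ 2], the inequality factors as
     [0 <= s (p + q) (p q - g)]. *)
  have : (g - j%:R) * s / p <= - ((g - k%:R) * s / q).
    rewrite -mulNr ler_pdivrMr // mulrAC ler_pdivlMr // -pE -qE.
    rewrite -subr_ge0 (_ : _ - _ = s * (p + q) * (p * q - g)); last by ring.
    by rewrite mulr_ge0 ?subr_ge0 // mulr_ge0 ?addr_ge0 ?ltW.
  by move=> /Phi_le; rewrite PhiN => h1; apply: reflected h1 _ _; exact: Phi_ge0.
- move=> j k j0 k0 h1 h2; rewrite !FE //; have [p0 pE] := sq j j0; have [q0 qE] := sq k k0.
  set p := Num.sqrt j%:R in p0 pE *; set q := Num.sqrt k%:R in q0 qE *.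
  have pq : p <= q by rewrite /p /q ler_wsqrtr //; have := t_ge0; lra.
  have : (g - k%:R) * s / q <= (g - t - j%:R) * s / p.
    apply: (@le_trans _ _ ((g - k%:R) * s / p)).
      by rewrite ler_wpM2l ?mulr_ge0 ?subr_ge0 ?(ltW s0) // lef_pV2 ?posrE.
    rewrite ler_wpM2r ?invr_ge0 ?(ltW p0) // ler_wpM2r ?(ltW s0) //; have := t_ge0; lra.
  by move=> /Phi_le h'; apply: disjoint h' _ _; [exact: Phi_le1|exact: Phi_ge0].
- move=> j k rho j0 k0 h1 r0 h2 h3; rewrite !FE //.
  have [p0 pE] := sq j j0; have [q0 qE] := sq k k0.
  set p := Num.sqrt j%:R in p0 pE *; set q := Num.sqrt k%:R in q0 qE *.
  have qp : q <= rho * p.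
    rewrite -(@ler_pXn2r _ 2) ?nnegrE ?mulr_ge0 // ?(ltW p0) ?(ltW q0) //.
    by rewrite exprMn pE qE.
  have : (g - k%:R) * s / q <= (g - t - j%:R) * s / p.
    rewrite ler_pdivrMr // mulrAC ler_pdivlMr // -subr_ge0.
    rewrite (_ : _ - _ = s * (q * (g - t - j%:R) - p * (g - k%:R))); last by ring.
    rewrite mulr_ge0 ?(ltW s0) // subr_ge0.
    (* If the lower end of window [j] is nonpositive, [q <= rho * p] compares the two ends; if it is
       positive, it exceeds the upper end of window [k], which is nonpositive by [g <= k]. *)
    have [h|h] := leP (g - t - j%:R) 0.
      have h4 : q * - (g - t - j%:R) <= rho * p * - (g - t - j%:R).
        by rewrite ler_wpM2r // oppr_ge0.
      have h5 : p * (rho * (j%:R + t - g)) <= p * (k%:R - g) by rewrite ler_wpM2l ?(ltW p0).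
      lra.
    apply: (@le_trans _ _ 0); first by rewrite mulr_ge0_le0 ?(ltW p0) // subr_le0.
    by rewrite mulr_ge0 // ltW.
  by move=> /Phi_le h'; apply: disjoint h' _ _; [exact: Phi_le1|exact: Phi_ge0].
- move=> k eta _ k0 e0 h; rewrite FE //; have [q0 qE] := sq k k0.
  set q := Num.sqrt k%:R in q0 qE *.
  have ts : t * s / q <= eta.
    rewrite ler_pdivrMr // -(@ler_pXn2r _ 2) ?nnegrE ?mulr_ge0 // ?(ltW s0) ?(ltW q0) //.
    by rewrite [leRHS]exprMn qE.
  have xy : (g - t - k%:R) * s / q <= (g - k%:R) * s / q.
    by rewrite ler_wpM2r ?invr_ge0 ?(ltW q0) // ler_wpM2r ?(ltW s0) //; have := t_ge0; lra.
  have := Phi_lipschitz_offset xy.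
  rewrite (_ : (g - k%:R) * s / q - _ = t * s / q); last by ring.
  lra.
Qed.
End Windows.

(** * Bounds on the approximation error *)

Section Spread.
Import mathcomp.boot.finset.
Context {R : realType} {m : nat}.
Variable w : 'I_m -> R.
Implicit Types (A : {set 'I_m}).

Let dev j := w j - weight_mean w.

Let sum_dev : (0 < m)%N -> \sum_j dev j = 0.
Proof.
move=> m0; rewrite sumrB sumr_const card_ord -[X in _ - X]mulr_natr divfK ?subrr //.
by rewrite pnatr_eq0 -lt0n.
Qed.

Lemma weight_var_ge0 : 0 <= weight_var w.
Proof. by rewrite divr_ge0 // sumr_ge0 // => j _; exact: sqr_ge0. Qed.

Lemma weight_var_eq0 j : weight_var w = 0 -> w j = weight_mean w.
Proof.
have m0 : (0 < m)%N by case: m j => [[]|].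
move/eqP; rewrite mulf_eq0 invr_eq0 pnatr_eq0 eqn0Ngt m0 orbF => /eqP h.
have /eqP := psumr_eq0P (fun i _ => sqr_ge0 (dev i)) h (i := j) isT.
by rewrite sqrf_eq0 subr_eq0 => /eqP.
Qed.

(* Cauchy-Schwarz on [A] and on its complement, whose deviations have opposite sums. *)
Lemma sqr_sum_dev A :
  (\sum_(j in A) (w j - weight_mean w)) ^+ 2 <= weight_var w * (#|A| * (m - #|A|))%:R.
Proof.
have [m0|m0] := posnP m.
  have -> : A = set0 by apply/setP => -[j jm]; exfalso; rewrite m0 in jm.
  by rewrite big_set0 expr0n /= cards0 mulr0.
set d := \sum_(j in A) _.
have dC : \sum_(j in ~: A) dev j = - d.
  have := sum_dev m0; rewrite (bigID (mem A)) /= => /eqP.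
  rewrite addrC addr_eq0 => /eqP <-.
  by apply: eq_bigl => j; rewrite inE.
have cs (B : {set 'I_m}) : (\sum_(j in B) dev j) ^+ 2 <= #|B|%:R * \sum_(j in B) dev j ^+ 2.
  set S := \sum_(j in B) dev j; set Q := \sum_(j in B) _.
  have [B0|B0] := posnP #|B|.
    by rewrite /S (cards0_eq B0) big_set0 expr0n /= cards0 mul0r.
  have B0' : 0 < #|B|%:R :> R by rewrite ltr0n.
  have : 0 <= \sum_(j in B) (#|B|%:R * dev j - S) ^+ 2.
    by apply: sumr_ge0 => j _; exact: sqr_ge0.
  have -> : \sum_(j in B) (#|B|%:R * dev j - S) ^+ 2 = #|B|%:R * (#|B|%:R * Q - S ^+ 2).
    transitivity (\sum_(j in B) (#|B|%:R ^+ 2 * dev j ^+ 2 - 2 * #|B|%:R * S * dev j + S ^+ 2)).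
      by apply: eq_bigr => j _; ring.
    rewrite !big_split /= sumr_const sumrN -!mulr_sumr -/S -/Q -(mulr_natl _ #|B|).
    by ring.
  by rewrite pmulr_rge0 // subr_ge0.
have := cs A; have := cs (~: A); rewrite dC -/d sqrrN.
have cC : #|~: A| = (m - #|A|)%N by rewrite cardsCs setCK card_ord.
have -> : weight_var w = (\sum_(j in A) dev j ^+ 2 + \sum_(j in ~: A) dev j ^+ 2) / m%:R.
  rewrite /weight_var [X in X / _](bigID (mem A)) /=; congr ((_ + _) / _).
  by apply: eq_bigl => j; rewrite inE.
have Am : (#|A| <= m)%N by rewrite -[X in (_ <= X)%N](card_ord m) max_card.
rewrite cC natrM natrB // mulrAC ler_pdivlMr ?ltr0n //.
have b0 : 0 <= #|A|%:R :> R by [].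
have ab : #|A|%:R <= m%:R :> R by rewrite ler_nat.
move: (\sum_(j in A) _) (\sum_(j in ~: A) _) b0 ab => p q.
move: (m%:R) (#|A|%:R) => a b b0 ab h1 h2.
have h3 := ler_wpM2l b0 h1.
have h4 : (a - b) * d ^+ 2 <= (a - b) * (b * p) by rewrite ler_wpM2l // subr_ge0.
lra.
Qed.
End Spread.

Section MarginalContribution.
Import mathcomp.boot.finset.
Context {R : realType} {m : nat}.
Variables (w : 'I_m -> R) (gamma : R) (M : 'I_m).
Hypothesis w_ge0 : forall j, 0 <= w j.

Notation contrib := (exp_marg_contrib w gamma M).
Notation mean := (weight_mean w).
Notation var := (weight_var w).

Let m_gt0 : (0 < m)%N. Proof. by case: m M => [[]|]. Qed.

Lemma weight_mean_ge0 : 0 <= mean.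
Proof. by rewrite divr_ge0 // sumr_ge0. Qed.

Lemma contrib0 : contrib 0 = ((gamma <= w M) && (0 < gamma))%R%:R.
Proof.
rewrite /exp_marg_contrib !mul0r eqxx subr_le0; by case: (_ && _).
Qed.

Lemma contrib_point k : var = 0 ->
  contrib k = ((gamma - w M <= k%:R * mean) && (k%:R * mean < gamma))%R%:R.
Proof. by move=> v0; rewrite /exp_marg_contrib v0 mulr0 eqxx; case: (_ && _). Qed.

Lemma contrib_normal k : (0 < k)%N -> 0 < var ->
  contrib k = Phi ((gamma - k%:R * mean) / (Num.sqrt k%:R * Num.sqrt var)) -
              Phi ((gamma - w M - k%:R * mean) / (Num.sqrt k%:R * Num.sqrt var)).
Proof.
move=> k0 v0; have kv : 0 < k%:R * var by rewrite mulr_gt0 // ltr0n.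
have ab : gamma - w M <= gamma by rewrite lerBlDr lerDl.
by rewrite /exp_marg_contrib (gt_eqF kv) normal_prob_co ?sqrtr_gt0 // sqrtrM.
Qed.

Lemma contrib_ge0 k : 0 <= contrib k.
Proof.
rewrite /exp_marg_contrib; case: ifP => _; first by case: ifP.
exact: fine_ge0.
Qed.

Lemma contrib_le1 k : contrib k <= 1.
Proof.
have [->|k0] := posnP k; first by rewrite contrib0; case: (_ && _).
have := weight_var_ge0 w; rewrite le_eqVlt => /predU1P[/esym/contrib_point ->|v0].
  by case: (_ && _).
rewrite contrib_normal //; set x := Phi _; set y := Phi _.
have : x <= 1 := Phi_le1 _; have : 0 <= y := Phi_ge0 _; lra.
Qed.

Lemma contrib_le_half k : gamma <= 0 -> contrib k <= 1 / 2.
Proof.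
move=> g0; have hk : gamma <= k%:R * mean.
  by apply: (le_trans g0); rewrite mulr_ge0 // weight_mean_ge0.
have [->|k0] := posnP k.
  by rewrite contrib0 (le_gtF g0) andbF /= mulr0n; lra.
have := weight_var_ge0 w; rewrite le_eqVlt => /predU1P[/esym/contrib_point ->|v0].
  by rewrite (le_gtF hk) andbF /= mulr0n; lra.
rewrite contrib_normal //; set x := Phi _; set y := Phi _.
have : 0 <= y := Phi_ge0 _; have : x <= 1 / 2; last by lra.
apply: Phi_half; rewrite pmulr_lle0 ?subr_le0 // invr_gt0 mulr_gt0 ?sqrtr_gt0 ?ltr0n //.
Qed.

Hypothesis mean_gt0 : 0 < mean.
Hypothesis gamma_gt0 : 0 < gamma.

Lemma contrib_window :
  window_excess (w M / mean) (gamma / mean) (w M ^+ 2 / var)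
    (fun k => contrib k - 1 / 2).
Proof.
have t0 : 0 <= w M / mean by rewrite divr_ge0 // ltW.
have g0 : 0 < gamma / mean by rewrite divr_gt0.
have h1 k : contrib k - 1 / 2 <= 1 / 2 by have := contrib_le1 k; lra.
have mean0 : mean != 0 by rewrite gt_eqF.
have := weight_var_ge0 w; rewrite le_eqVlt => /predU1P[/esym v0|v0].
  apply: point_window_excess => // [|k k0].
    by rewrite (weight_var_eq0 M v0) divff.
  rewrite contrib_point // -mulrBl ler_pdivrMr // ltr_pdivlMr //.
have s0 : 0 < mean / Num.sqrt var by rewrite divr_gt0 // sqrtr_gt0.
have sv0 : Num.sqrt var != 0 by rewrite gt_eqF // sqrtr_gt0.
have -> : w M ^+ 2 / var = (w M / mean * (mean / Num.sqrt var)) ^+ 2.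
  by rewrite mulrA divfK // exprMn exprVn sqr_sqrtr // ltW.
apply: (normal_window_excess t0 g0 s0) => // k k0.
have sk0 : Num.sqrt k%:R != 0 :> R by rewrite gt_eqF // sqrtr_gt0 ltr0n.
rewrite contrib_normal //; congr (Phi _ - Phi _ - _); field; apply/and3P; split => //.
Qed.

Let scale (C : R) : 0 < var -> (w M - mean) ^+ 2 <= var * C ->
  w M ^+ 2 / var * (w M / mean - 1) ^+ 2 <= C * (w M / mean) ^+ 2.
Proof.
move=> v0 h; rewrite -subr_ge0.
rewrite (_ : _ - _ = (w M / mean) ^+ 2 / var * (var * C - (w M - mean) ^+ 2)).
  by rewrite mulr_ge0 ?subr_ge0 // divr_ge0 ?sqr_ge0 // ltW.
by field; rewrite (gt_eqF v0) (gt_eqF mean_gt0).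
Qed.

Let heavy_var : 1 < w M / mean -> 0 < var /\ mean < w M.
Proof.
rewrite ltr_pdivlMr // mul1r => aM; split=> //; rewrite lt_neqAle weight_var_ge0 andbT.
by apply/eqP => /esym/(weight_var_eq0 M) h; rewrite h ltxx in aM.
Qed.

Lemma window_scale : 1 < w M / mean ->
  w M ^+ 2 / var * (w M / mean - 1) ^+ 2 <= (m%:R - 1) * (w M / mean) ^+ 2.
Proof.
move=> /heavy_var[v0 aM]; apply: scale => //.
by have := sqr_sum_dev w [set M]; rewrite big_set1 cards1 mul1n natrB.
Qed.

(** Both [z] and [M] deviate from the mean by at least [w M - mean > 0], so [sqr_sum_dev] on the
    pair gives [4 (w M - mean) ^ 2 <= 2 (m - 2) var]: half the constant m - 2 remains. *)
Lemma window_scale2 z : z != M -> w M <= w z -> 1 < w M / mean ->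
  w M ^+ 2 / var * (w M / mean - 1) ^+ 2 <= (m%:R - 2) / 2 * (w M / mean) ^+ 2.
Proof.
move=> zM Mz /heavy_var[v0 aM]; apply: scale => //.
have m2 : (2 <= m)%N.
  by have := max_card (mem [set z; M]); rewrite cards2 zM card_ord.
have := sqr_sum_dev w [set z; M].
rewrite big_setU1 ?inE // big_set1 cards2 zM natrM natrB //= => h.
have : (2 * (w M - mean)) ^+ 2 <= (w z - mean + (w M - mean)) ^+ 2.
  by rewrite ler_pXn2r ?nnegrE //; lra.
lra.
Qed.
End MarginalContribution.

Section ErrorBounds.
Import mathcomp.boot.finset.
Context {R : realType} {m : nat}.
Variables (w : 'I_m -> R) (gamma : R) (M : 'I_m).
Hypothesis w_ge0 : forall j, 0 <= w j.
Hypothesis gamma_ge0 : 0 <= gamma.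
Hypothesis gamma_le : gamma <= \sum_j w j.

Notation contrib := (exp_marg_contrib w gamma M).
Notation mean := (weight_mean w).
Notation pivot := (pivot_freq w gamma M).
Notation err := (shapley_approx_error w gamma M).

Let m_gt0 : (0 < m)%N. Proof. by case: m M => [[]|]. Qed.
Let m_gt0' : 0 < m%:R :> R. Proof. by rewrite ltr0n. Qed.

Let pivot0 : gamma = 0 -> pivot 0 = 0.
Proof.
move=> g0; rewrite /pivot_freq !freq_eq0 ?subrr // => S _; rewrite -leNgt g0; exact: sumr_ge0.
Qed.

Lemma error_sum : m%:R * err = \sum_(1 <= k < m) (contrib k - pivot k).
Proof.
rewrite /shapley_approx_error shapley_value_freq /approx_shapley_value -sumrB mulr_sumr.
transitivity (\sum_(0 <= k < m) (contrib k - pivot k)).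
  rewrite big_mkord; apply: eq_bigr => k _; rewrite -mulrBl mulrC divfK // gt_eqF //.
rewrite big_ltn // contrib0.
have [g0|g0] := ltP 0 gamma.
  by rewrite pivot_freq0 // andbT subrr add0r.
by rewrite andbF pivot0 ?subrr ?add0r //; apply/eqP; rewrite eq_le g0.
Qed.

Let sum1 (c : R) : \sum_(1 <= k < m) c = (m%:R - 1) * c.
Proof. by rewrite sumr_const_nat -[in RHS](natrB _ m_gt0) mulr_natl. Qed.

Lemma error_ge : - ((m%:R - 1) / m%:R) <= err.
Proof.
rewrite -mulNr ler_pdivrMr // [leRHS]mulrC error_sum -[leLHS]mulr1 mulNr -sum1 -sumrN.
apply: ler_sum_nat => k /andP[_ km].
by have := contrib_ge0 w gamma M k; have := pivot_freq_le1 w gamma M km; lra.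
Qed.

Lemma error_le1 : err <= (m%:R - 1) / m%:R.
Proof.
rewrite ler_pdivlMr // [leLHS]mulrC error_sum -[leRHS]mulr1 -sum1.
apply: ler_sum_nat => k /andP[_ km].
by have := contrib_le1 gamma M w_ge0 k; have := pivot_freq_ge0 gamma M w_ge0 k; lra.
Qed.

(** If [M] reaches the cutoff alone, the case split is by the weight of the rivals: next to nothing,
    which makes [M] a dictator; at least twice the cutoff, where the excesses sum to at most 0; or
    in between, where complementary coalitions bound the exact frequencies from below. *)
Lemma error_le_slack : (4 <= m <= 10)%N ->
  err <= ((m%:R - 1) / 2 + @slack R m) / m%:R.
Proof.
move=> hm; rewrite ler_pdivlMr // [leLHS]mulrC error_sum.
have slack0 : 0 <= @slack R m by rewrite /slack; do ?case: ifP => _; lra.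
have m4 : 4 <= m%:R :> R by rewrite ler_nat; case/andP: hm.
have [g0|g0] := leP gamma 0.
  apply: (@le_trans _ _ (\sum_(1 <= k < m) (1 / 2 : R))).
    apply: ler_sum_nat => k _.
    by have := contrib_le_half M w_ge0 k g0; have := pivot_freq_ge0 gamma M w_ge0 k; lra.
  by rewrite sum1; lra.
pose F k := contrib k - 1 / 2.
suff : \sum_(1 <= k < m) F k <= @slack R m + \sum_(1 <= k < m) pivot k.
  rewrite /F !sumrB sum1; lra.
have W0 : 0 < \sum_j w j by exact: lt_le_trans gamma_le.
have mean0 : 0 < mean by rewrite divr_gt0.
have H := contrib_window M w_ge0 mean0 g0.
have t0 : 0 <= w M / mean by rewrite divr_ge0 // ltW.
have Wm : \sum_j w j = m%:R * mean by rewrite mulrC divfK // gt_eqF.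
have E0 : 0 <= \sum_(1 <= k < m) pivot k by apply: sumr_ge0 => k _; exact: pivot_freq_ge0.
have [gM|Mg] := leP gamma (w M); last first.
  have tg : w M / mean < gamma / mean by rewrite ltr_pM2r ?invr_gt0.
  have alpha : 1 <= \sum_(1 <= k < m) pivot k ->
      \sum_(1 <= k < m) F k <= @slack R m + \sum_(1 <= k < m) pivot k.
    move=> E1; have := excess_le_slack_add1 H t0 tg (window_scale mean0 (M := M)) hm erefl.
    by rewrite -/F; lra.
  have [veto|nveto] := ltP (\sum_j w j - w M) gamma.
    by apply: alpha; apply: sum_pivot_veto => //; case/andP: hm => /(leq_trans (isT : 1 < 4)%N).
  have [/existsP[z /andP[zM Mz]]|] := boolP [exists z, (z != M) && (w M < w z)]; last first.
    move=> /existsPn h; apply: alpha; apply: sum_pivot_heaviest => // j jM.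
    by have := h j; rewrite jM /= -leNgt.
  have := excess_le_slack H t0 tg (window_scale2 mean0 zM (ltW Mz)) hm erefl.
  rewrite -/F => /(_ _)/le_trans; apply; last by lra.
  by rewrite ler_pdivrMr // mulrBl divfK ?gt_eqF // -Wm; lra.
have Fh k : F k <= 1 / 2 by have := contrib_le1 gamma M w_ge0 k; rewrite /F; lra.
have sumF n : (0 < n)%N -> \sum_(1 <= k < n) F k <= (n%:R - 1) / 2.
  move=> n0; have := ler_sum_nat (fun k (_ : (1 <= k < n)%N) => Fh k).
  by rewrite sumr_const_nat -[X in _ <= X -> _]mulr_natl natrB // mulrA mulr1.
(* Beyond [(m - 1) * mean], [M] leaves its rivals less than one mean, which is below the cutoff. *)
have [gm|gm] := leP gamma ((m%:R - 1) * mean); last first.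
  have E1 : \sum_(1 <= k < m) pivot k = m%:R - 1.
    rewrite -[RHS]mulr1 -sum1; apply: eq_big_nat => k /andP[_ km].
    apply: pivot_freq_dictator => //; rewrite Wm.
    have : 3 * mean <= (m%:R - 1) * mean by rewrite ler_wpM2r ?(ltW mean0) //; lra.
    by have := mean0; lra.
  by have := sumF m m_gt0; lra.
have [g2|g2] := leP (2 * gamma) (\sum_j w j - w M).
  have g0' : 0 <= gamma / mean by rewrite divr_ge0 // ltW.
  have gt : gamma / mean <= w M / mean by rewrite ler_wpM2r ?invr_ge0 // ltW.
  have := excess_le0 H hm g0' gt; rewrite -/F => /(_ _)/le_trans; apply; last by lra.
  by rewrite mulrA ler_pdivrMr // mulrBl divfK ?gt_eqF // -Wm.
have := sum_pivot_alone w_ge0 g0 gM g2.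
(* The other m - 2 sizes have excess at most (m - 2) / 2, exactly what [sum_pivot_alone] pays. *)
have last_le0 : F m.-1 <= 0.
  apply: (we_high H); first by rewrite -subn1 subn_gt0; case/andP: hm => /(leq_trans (isT : 1 < 4)%N).
  by rewrite ler_pdivrMr // -subn1 natrB.
have m1 : (1 <= m.-1)%N by rewrite -ltnS prednK //; case/andP: hm => /(leq_trans (isT : 1 < 4)%N).
have -> : \sum_(1 <= k < m) F k = \sum_(1 <= k < m.-1) F k + F m.-1.
  by rewrite -[in LHS](prednK m_gt0) big_nat_recr.
have := sumF m.-1 m1; have -> : m.-1%:R = m%:R - 1 :> R by rewrite -subn1 natrB.
lra.
Qed.
End ErrorBounds.

(** * An interval of length [sqrt (2 c)] containing all errors *)

Section ErrorRange.
Context {R : realType}.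

Definition known_bound (m : nat) : R := Num.sqrt (8 / (m%:R * pi)).

Definition error_width (m : nat) : R := Num.sqrt (2 * known_bound m).

(** Up to m = 4 the trivial bound (m - 1) / m is sharper than [known_bound m]; for m <= 3 even its
    symmetric interval is short enough. *)
Definition error_floor (m : nat) : R :=
  if (m <= 4)%N then - ((m%:R - 1) / m%:R) else - known_bound m.

Let width_ge0 m : 0 <= error_width m. Proof. exact: sqrtr_ge0. Qed.

Lemma sqr_error_width m : error_width m ^+ 2 = 2 * known_bound m.
Proof. by rewrite sqr_sqrtr // mulr_ge0 // sqrtr_ge0. Qed.

Lemma sqr_known_bound m : (0 < m)%N -> known_bound m ^+ 2 = 8 / (m%:R * pi).
Proof. by move=> m0; rewrite sqr_sqrtr // divr_ge0 // mulr_ge0 // pi_ge0. Qed.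

Let width4 m : (0 < m)%N -> error_width m ^+ 4 * (m%:R * pi) = 32.
Proof.
move=> m0; rewrite (_ : _ ^+ 4 = (error_width m ^+ 2) ^+ 2); last by ring.
rewrite sqr_error_width exprMn sqr_known_bound //.
have m0' : m%:R != 0 :> R by rewrite pnatr_eq0 -lt0n.
by move: (pi : R) (lt0r_neq0 (pi_gt0 R)) => p p0; field; apply/andP.
Qed.

(** By [width4] the fourth power of the width times m is 32 / pi, which exceeds 10 because
    [pi < 32 / 10]. *)
Let width_ge m (y : R) : (0 < m)%N -> 0 <= y -> y ^+ 4 * m%:R <= 10 -> y <= error_width m.
Proof.
move=> m0 y0 h; rewrite leNgt; apply/negP => wy.
have := width4 m0; have p := @pi_lt R; have p0 := pi_gt0 R.
have h4 : error_width m ^+ 4 < y ^+ 4 by rewrite ltrXn2r // nnegrE.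
have mp : 0 < m%:R * pi :> R by rewrite mulr_gt0 // ltr0n.
have h5 : error_width m ^+ 4 * (m%:R * pi) < y ^+ 4 * (m%:R * pi) by rewrite ltr_pM2r.
have h6 : y ^+ 4 * m%:R * pi <= 10 * pi by rewrite ler_wpM2r // ltW.
by lra.
Qed.

Let width_le m (y : R) : (0 < m)%N -> 0 <= y -> 32 <= y ^+ 4 * m%:R * (314 / 100) ->
  error_width m <= y.
Proof.
move=> m0 y0 h; rewrite leNgt; apply/negP => wy.
have := width4 m0; have p := @pi_gt R; have p0 := pi_gt0 R.
have h4 : y ^+ 4 < error_width m ^+ 4 by rewrite ltrXn2r // nnegrE.
have mp : 0 < m%:R * pi :> R by rewrite mulr_gt0 // ltr0n.
have h5 : y ^+ 4 * (m%:R * pi) < error_width m ^+ 4 * (m%:R * pi) by rewrite ltr_pM2r.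
have h6 : y ^+ 4 * m%:R * (314 / 100) <= y ^+ 4 * m%:R * pi.
  by rewrite ler_wpM2l ?mulr_ge0 ?exprn_ge0 // ltW.
by lra.
Qed.

(* For [y = error_width m], [y - y ^+ 2 / 2] is [error_width m - known_bound m].  It is
   concave, hence at least the smaller of its values at 95 / 100 and at [y1]. *)
Let parabola (y u y1 : R) : 95 / 100 <= y -> y <= y1 ->
  u <= 498 / 1000 -> u <= y1 - y1 ^+ 2 / 2 -> u <= y - y ^+ 2 / 2.
Proof.
move=> h0 h1 u0 u1; have [y_le1|y_gt1] := leP y 1.
  have : 0 <= (y - 95 / 100) * (105 / 100 - y) by apply: mulr_ge0; lra.
  by lra.
have : 0 <= (y1 - y) * (y1 + y - 2) by apply: mulr_ge0; lra.
by lra.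
Qed.

Lemma error_range (m : nat) (w : 'I_m -> R) (gamma : R) (M : 'I_m) :
  (forall j, 0 <= w j) -> 0 <= gamma -> gamma <= \sum_j w j ->
  - known_bound m <= shapley_approx_error w gamma M <= known_bound m ->
  error_floor m <= shapley_approx_error w gamma M <= error_floor m + error_width m.
Proof.
move=> w0 g0 gW /andP[lo hi].
have m0 : (0 < m)%N by case: m M {w w0 gW lo hi} => [[]|].
have e1 := error_ge M w0 g0; have e2 := error_le1 M w0 g0.
have sl := error_le_slack M w0 g0 gW.
move: (shapley_approx_error w gamma M) lo hi e1 e2 sl => e lo hi e1 e2 sl.
have cE : known_bound m = error_width m ^+ 2 / 2 by rewrite sqr_error_width; field.
have [m4|m4] := leqP m 4.
  rewrite /error_floor m4 e1 /=.
  have : m \in iota 1 4 by rewrite mem_iota m0.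
  rewrite !inE => /or4P[] /eqP mE; rewrite mE in m4 e1 e2 lo hi sl *.
  - by have := width_ge0 1; lra.
  - have : 1 <= error_width 2 by apply: width_ge => //; lra.
    lra.
  - have : 4 / 3 <= error_width 3 by apply: width_ge => //; lra.
    lra.
  - have : 5 / 4 <= error_width 4 by apply: width_ge => //; lra.
    have := sl isT; rewrite (_ : slack 4 = 1 / 2) //; lra.
rewrite /error_floor leqNgt m4 /= lo /=.
have [m10|m10] := leqP m 10; last first.
  (* A width [y <= 1] gives [2 c = y ^ 2 <= y], so the known symmetric interval fits. *)
  have : error_width m <= 1.
    apply: width_le => //; rewrite expr1n mul1r.
    have : 11 <= m%:R :> R by rewrite ler_nat.
    by lra.
  have := width_ge0 m; rewrite cE in hi *.
  move: (error_width m) hi => y hi y0 y1.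
  have : 0 <= y * (1 - y) by apply: mulr_ge0; lra.
  by lra.
have hm : (4 <= m <= 10)%N by rewrite m10 ltnW.
apply: le_trans (sl hm) _; rewrite cE [leRHS]addrC.
have w1 : 95 / 100 <= error_width m.
  have m10' : m%:R <= 10 :> R by rewrite ler_nat.
  by apply: width_ge => //; lra.
have := mem_iota4 hm; rewrite !inE => /or4P[|||/or4P[]] /eqP mE; rewrite mE in m4 w1 *.
- by [].
- have h : error_width 5 <= 120 / 100 by apply: width_le => //; lra.
  by apply: parabola w1 h _ _; rewrite (_ : slack 5 = 2 / 5) //; lra.
- have h : error_width 6 <= 115 / 100 by apply: width_le => //; lra.
  by apply: parabola w1 h _ _; rewrite (_ : slack 6 = 2 / 5) //; lra.
- have h : error_width 7 <= 110 / 100 by apply: width_le => //; lra.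
  by apply: parabola w1 h _ _; rewrite (_ : slack 7 = 9 / 20) //; lra.
- have h : error_width 8 <= 107 / 100 by apply: width_le => //; lra.
  by apply: parabola w1 h _ _; rewrite (_ : slack 8 = 12 / 25) //; lra.
- have h : error_width 9 <= 104 / 100 by apply: width_le => //; lra.
  by apply: parabola w1 h _ _; rewrite (_ : slack 9 = 12 / 25) //; lra.
- have h : error_width 10 <= 103 / 100 by apply: width_le => //; lra.
  by apply: parabola w1 h _ _; rewrite (_ : slack 10 = 12 / 25) //; lra.
Qed.
End ErrorRange.

Import HBNNSimple.
Local Open Scope classical_set_scope.

(** * Hoeffding's inequality *)

Section ProductExpectation.
Context {d : measure_display} {T : measurableType d} {R : realType}.
Variable P : probability T R.

Let integral_mul_nnsfun (G Y : T -> R) (f : {nnsfun R >-> R}) :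
  measurable_fun setT G -> (forall x, 0 <= G x) -> measurable_fun setT Y ->
  (\int[P]_x (G x * f (Y x))%:E =
   \sum_(r \in range f) (r%:E * \int[P]_x (G x * \1_(f @^-1` [set r]) (Y x))%:E))%E.
Proof.
move=> mG G0 mY.
have mfr r : measurable_fun setT (fun x => G x * \1_(f @^-1` [set r]) (Y x)).
  apply: measurable_funM => //.
  by apply: (measurableT_comp (f := \1_(f @^-1` [set r]) : R -> R)).
transitivity (\int[P]_x (\sum_(r \in range f) (r * (G x * \1_(f @^-1` [set r]) (Y x)))%:E))%E.
  apply: eq_integral => x _; rewrite fsumEFin // [in LHS]fimfunE; congr EFin.
  rewrite mulrC mulr_fsuml //; apply: eq_fsbigr => r _ /=; ring.
have r_ge0 r : r \in range f -> 0 <= r.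
  by rewrite inE => -[y _ <-].
rewrite ge0_integral_fsum //; first last.
- move=> r x _; rewrite lee_fin; have [r0|r0] := leP 0 r; first by rewrite !mulr_ge0.
  by rewrite preimage_nnfun0 // indic0 !mulr0.
- by move=> r; apply/measurable_EFinP/measurable_funM.
apply: eq_fsbigr => r /r_ge0 r0.
under eq_integral do rewrite EFinM.
rewrite ge0_integralZl_EFin //; last by apply/measurable_EFinP.
by move=> x _; rewrite lee_fin mulr_ge0.
Qed.

(** Extends the product rule from indicators of [Y] to nonnegative functions of [Y], by linearity on
    simple functions and monotone convergence; [c] stands for the integral of [G]. *)
Lemma ge0_integral_mul_indep (G Y : T -> R) (h : R -> R) (c : R) :
  measurable_fun setT G -> (forall x, 0 <= G x) -> measurable_fun setT Y ->
  measurable_fun setT h -> (forall y, 0 <= h y) ->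
  (forall B, measurable B -> (\int[P]_x (G x * \1_B (Y x))%:E =
     c%:E * P (Y @^-1` B))%E) ->
  (\int[P]_x (G x * h (Y x))%:E = c%:E * \int[P]_x (h (Y x))%:E)%E.
Proof.
move=> mG G0 mY mh h0 ind.
have mh' : measurable_fun setT (EFin \o h) by exact/measurable_EFinP.
pose f := nnsfun_approx measurableT mh'.
have lim_int (K : T -> R) : measurable_fun setT K -> (forall x, 0 <= K x) ->
    (\int[P]_x (K x * f n (Y x))%:E @[n --> \oo] --> \int[P]_x (K x * h (Y x))%:E)%E.
  move=> mK K0.
  have -> : (\int[P]_x (K x * h (Y x))%:E =
      \int[P]_x (limn (fun n => (K x * f n (Y x))%:E)))%E.
    apply: eq_integral => x _; apply/esym/cvg_lim => //.
    under eq_fun do rewrite EFinM.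
    rewrite EFinM; apply: cvgeZl => //.
    by apply: (cvg_nnsfun_approx measurableT mh') => // y _; rewrite lee_fin.
  apply: cvg_monotone_convergence => //.
  - move=> n; apply/measurable_EFinP/measurable_funM => //.
    by apply: (measurableT_comp (f := f n : R -> R)).
  - by move=> n x _; rewrite lee_fin mulr_ge0.
  - move=> x _ m n mn; rewrite lee_fin ler_wpM2l //.
    exact/lefP/nd_nnsfun_approx.
have step n : (\int[P]_x (G x * f n (Y x))%:E = c%:E * \int[P]_x (1 * f n (Y x))%:E)%E.
  rewrite !integral_mul_nnsfun // ge0_mule_fsumr; last first.
    move=> r; have [r0|r0] := leP 0 r.
      rewrite mule_ge0 // integral_ge0 // => x _; rewrite lee_fin mulr_ge0 //.
    by rewrite preimage_nnfun0 // integral0_eq ?mule0 // => x _; rewrite indic0 mulr0.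
  apply: eq_fsbigr => r _; rewrite ind // muleCA; congr (_ * (_ * _))%E.
  transitivity (\int[P]_x (\1_(Y @^-1` (f n @^-1` [set r])) x)%:E)%E.
    rewrite integral_indic ?setIT //; rewrite -[X in measurable X]setTI; exact: mY.
  by apply: eq_integral => x _; rewrite mul1r.
have l1 := lim_int _ mG G0.
have l2 := lim_int (cst 1) (measurable_cst _) (fun=> ler01).
have l3 : (c%:E * \int[P]_x (1 * f n (Y x))%:E @[n --> \oo] -->
    c%:E * \int[P]_x (1 * h (Y x))%:E)%E by exact: cvgeZl.
have e : (fun n => \int[P]_x (G x * f n (Y x))%:E)%E =
         (fun n => c%:E * \int[P]_x (1 * f n (Y x))%:E)%E by apply/funext.
rewrite e in l1.
rewrite (cvg_unique _ l1 l3) //; congr (_ * _)%E.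
by apply: eq_integral => x _; rewrite mul1r.
Qed.
End ProductExpectation.

Section Independence.
Context {d : measure_display} {T : measurableType d} {R : realType}.
Variables (P : probability T R) (n : nat) (X : 'I_n -> T -> R).
Hypothesis indX : independent_rvs P X.

Let mX i : measurable_fun setT (X i). Proof. by have [] := indX. Qed.

Let integral_indicator (Y : T -> R) (B : set R) : measurable_fun setT Y -> measurable B ->
  (\int[P]_x (\1_B (Y x))%:E = P (Y @^-1` B))%E.
Proof.
move=> mY mB; rewrite (_ : (fun x => (\1_B (Y x))%:E) = (fun x => (\1_(Y @^-1` B) x)%:E)) //.
by rewrite integral_indic ?setIT // -[X in measurable X]setTI; exact: mY.
Qed.

Let mprod (I : pred 'I_n) (g : 'I_n -> R -> R) :
  (forall i, measurable_fun setT (g i)) ->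
  measurable_fun setT (fun x => \prod_(i | I i) g i (X i x)).
Proof.
move=> mg; under eq_fun do rewrite -big_filter.
apply: measurable_prod => i _.
exact: (measurableT_comp (mg i) (mX i)).
Qed.

Let product_indicators (B : 'I_n -> set R) : (forall i, measurable (B i)) ->
  (\int[P]_x (\prod_i \1_(B i) (X i x))%:E = \prod_i P (X i @^-1` B i))%E.
Proof.
move=> mB; have [_ /(_ B mB) <-] := indX.
have mcap : measurable (\bigcap_(i in [set: 'I_n]) (X i @^-1` B i)).
  apply: fin_bigcap_measurable => // i _.
  by rewrite -[X in measurable X]setTI; exact: mX.
rewrite -[in RHS](setIT (\bigcap_(i in _) _)) -integral_indic //.
apply: eq_integral => x _; congr EFin; rewrite indicE.
have [/set_mem h|] := boolP (x \in _).
  by rewrite big1 // => i _; rewrite indicE mem_set //; exact: h.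
move/negP => h; have [i hi] : exists i, ~ (X i @^-1` B i) x.
  by apply/existsNP => hx; apply: h; apply/mem_set => i _.
by rewrite (bigD1 i) //= indicE memNset // mul0r.
Qed.

(* Induction on the number [k] of factors not yet known to be indicators. *)
Let product_from (c : R) (k : nat) (g : 'I_n -> R -> R) : 1 <= c ->
  (forall i, measurable_fun setT (g i)) ->
  (forall i y, 0 <= g i y <= c) ->
  (forall i : 'I_n, (k <= i)%N -> exists2 B, measurable B & g i = \1_B) ->
  (\int[P]_x (\prod_i g i (X i x))%:E = \prod_i \int[P]_x (g i (X i x))%:E)%E.
Proof.
move=> c1; elim: k g => [|k IH] g mg gc gB.
  have /choice[B hB] : forall i, exists B, measurable B /\ g i = \1_B.
    by move=> i; have [B mB gE] := gB i isT; exists B.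
  under eq_integral do under eq_bigr do rewrite (hB _).2.
  rewrite product_indicators; last by move=> i; exact: (hB i).1.
  by apply: eq_bigr => i _; rewrite (hB i).2 integral_indicator //; exact: (hB i).1.
have [kn|nk] := ltnP k n; last first.
  by apply: IH => // i ki; have := leq_trans nk ki; rewrite leqNgt ltn_ord.
pose j := Ordinal kn.
pose G x := \prod_(i | i != j) g i (X i x).
pose c' := fine (\prod_(i | i != j) \int[P]_x (g i (X i x))%:E)%E.
have fin i : (\int[P]_x (g i (X i x))%:E)%E \is a fin_num.
  rewrite ge0_fin_numE; last by apply: integral_ge0 => x _; rewrite lee_fin; have /andP[] := gc i (X i x).
  apply: (@le_lt_trans _ _ (\int[P]_x (cst c%:E x))%E).
    apply: ge0_le_integral => //.
    - by move=> x _; rewrite lee_fin; have /andP[] := gc i (X i x).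
    - by apply/measurable_EFinP; exact: (measurableT_comp (mg i) (mX i)).
    - by move=> x _; rewrite lee_fin; have /andP[] := gc i (X i x).
  rewrite integral_cst // [X in (_ * X < _)%E](_ : _ = 1%E) ?mule1 ?ltry //.
  exact: probability_setT.
have c'E : (c'%:E = \prod_(i | i != j) \int[P]_x (g i (X i x))%:E)%E.
  by rewrite fineK //; apply: (big_ind (fun y => y \is a fin_num)) => // y z; exact: fin_numM.
have ind B : measurable B -> (\int[P]_x (G x * \1_B (X j x))%:E = c'%:E * P (X j @^-1` B))%E.
  (* Turning factor [j] into an indicator brings the family under the induction hypothesis, which
     supplies the rule that [ge0_integral_mul_indep] extends back to [g j]. *)
  move=> mB; pose g' i := if i == j then \1_B else g i.
  have := IH g'; rewrite [in X in _ -> _ -> _ -> _ = X](bigD1 j) //=.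
  have g'j : g' j = \1_B by rewrite /g' eqxx.
  have g'N i : i != j -> g' i = g i by rewrite /g' => /negbTE ->.
  rewrite {1}g'j integral_indicator // => h.
  rewrite muleC c'E; under [in RHS]eq_bigr => i ij do rewrite -(g'N _ ij).
  rewrite -h.
  - apply: eq_integral => x _; rewrite (bigD1 j) //= g'j mulrC; congr (_ * _)%:E.
    by apply: eq_bigr => i /g'N ->.
  - by move=> i; rewrite /g'; case: ifP.
  - move=> i y; rewrite /g'; case: ifP => // _; rewrite indicE.
    by case: (_ \in _); rewrite ?ler01 ?lexx ?(le_trans ler01 c1).
  - move=> i; rewrite leq_eqVlt /g' => /predU1P[ki|/gB]; last first.
      by case: ifP => // _ _; exists B.
    have ij : i = j by apply/val_inj; exact: esym.
    by rewrite ij eqxx; exists B.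
transitivity (\int[P]_x (G x * g j (X j x))%:E)%E.
  by apply: eq_integral => x _; rewrite (bigD1 j) //= mulrC.
rewrite (ge0_integral_mul_indep (c := c')) //.
- by rewrite [RHS](bigD1 j) //= muleC c'E.
- by apply: mprod.
- by move=> x; apply: prodr_ge0 => i _; have /andP[] := gc i (X i x).
- by move=> y; have /andP[] := gc j y.
Qed.

Lemma integral_prod_indep (g : 'I_n -> R -> R) (c : R) :
  (forall i, measurable_fun setT (g i)) -> (forall i y, 0 <= g i y <= c) ->
  (\int[P]_x (\prod_i g i (X i x))%:E = \prod_i \int[P]_x (g i (X i x))%:E)%E.
Proof.
(* The bound is raised to at least 1 so that the indicators introduced by the induction obey it
   too. *)
move=> mg gc; apply: (@product_from (Num.max 1 c) n) => //.
- by rewrite le_max lexx.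
- by move=> i y; have /andP[-> h] := gc i y; rewrite le_max h orbT.
- by move=> i; rewrite leqNgt ltn_ord.
Qed.
End Independence.

Section HoeffdingLemma.
Context {R : realType}.

Lemma expR_chord (u h : R) : 0 <= u <= 1 -> 0 <= h ->
  expR (u * h) <= 1 - u + u * expR h.
Proof.
move=> /andP[u0 u1] h0; pose f (z : R) := 1 - u + u * expR z - expR (u * z).
have Df (z : R) : is_derive z (1 : R) f (u * (expR z - expR (u * z))).
  by apply: is_derive_eq; rewrite /GRing.scale /=; ring.
have := derive_ge0_le Df (a := 0) _ h0; rewrite /f mulr0 expR0.
suff /[swap] /[apply] : forall z : R, 0 <= z -> 0 <= u * (expR z - expR (u * z)) by lra.
by move=> z z0; rewrite mulr_ge0 // subr_ge0 ler_expR; nra.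
Qed.

(* The second derivative in [h] of [h^2 / 8] minus the logarithm of the left-hand
   side is [(1 / 2 - p)^2], where [p] is the tilted mean. *)
Lemma bernoulli_mgf (q h : R) : 0 <= q <= 1 -> 0 <= h ->
  1 - q + q * expR h <= expR (q * h + h ^+ 2 / 8).
Proof.
move=> /andP[q0 q1] h0.
pose L (z : R) := 1 - q + q * expR z.
have L0 z : 0 < L z by rewrite /L; have := expR_gt0 z; nra.
pose D' (z : R) := q + z / 4 - q * expR z / L z.
have DL (z : R) : is_derive z (1 : R) L (q * expR z).
  by apply: is_derive_eq; rewrite /GRing.scale /=; ring.
have DD' (z : R) : is_derive z (1 : R) D' ((1 / 2 - q * expR z / L z) ^+ 2).
  have Lz := L0 z; have DV := is_deriveV (lt0r_neq0 Lz) (DL z).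
  apply: is_derive_eq; rewrite /GRing.scale /=.
  have -> : L z = 1 - q + q * expR z by [].
  by field; rewrite -/(L z) gt_eqF.
pose D (z : R) := q * z + z ^+ 2 / 8 - ln (L z).
have DD (z : R) : is_derive z (1 : R) D (D' z).
  have Lz := L0 z; have DV := is_derive1_comp (is_derive1_ln Lz) (DL z).
  apply: is_derive_eq; rewrite /GRing.scale /= /D'; field.
  by rewrite -/(L z) gt_eqF.
have D'0 y : 0 <= y -> 0 <= D' y.
  move=> y0; have := derive_ge0_le DD' (a := 0) (fun z _ => sqr_ge0 _) y0.
  by rewrite /D' /L expR0 mul0r addr0 mulr1 subrK divr1 subrr.
have := derive_ge0_le DD (a := 0) D'0 h0.
rewrite /D /L expR0 mulr1 subrK ln1 mulr0 expr0n mul0r addr0 subrr subr_ge0 => hh.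
by rewrite -[leLHS]lnK ?posrE ?ler_expR // ; exact: L0.
Qed.
End HoeffdingLemma.

Section Tail.
Context {d : measure_display} {T : measurableType d} {R : realType}.
Variable P : probability T R.

Let integral_cst_prob (c : R) : (\int[P]_x c%:E = c%:E)%E.
Proof.
rewrite (@integral_cst _ _ _ P setT measurableT c%:E) [X in (_ * X)%E](_ : _ = 1%E) ?mule1 //; exact: probability_setT.
Qed.

Lemma bounded_integrable (X : T -> R) (a b : R) : measurable_fun setT X ->
  (forall x, a <= X x <= b) -> P.-integrable setT (fun x => (X x)%:E).
Proof.
move=> mX Xab; apply: measurable_bounded_integrable => //.
  by rewrite (_ : _ setT = 1%E) ?ltry //; exact: probability_setT.
exists (`|a| + `|b|); split; first exact: num_real.
move=> y yab x _ /=; apply: le_trans (ltW yab).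
have /andP[h1 h2] := Xab x.
rewrite ler_norml; apply/andP; split.
  by have := ler_norm (- a); rewrite normrN; have := normr_ge0 b; lra.
by have := ler_norm b; have := normr_ge0 a; lra.
Qed.

Let integrable_cst (c : R) : P.-integrable setT (fun=> c%:E).
Proof. by apply: (@bounded_integrable (fun=> c) c c) => // x; rewrite lexx. Qed.

(** Replacing the exponential by its chord over the interval makes the integrand affine in [X]. Its
    integral is then that of a two-point variable with the same mean, which [bernoulli_mgf] bounds
    with [q = (mu - a) / D]. *)
Lemma hoeffding_mgf (X : T -> R) (a D l : R) : measurable_fun setT X -> 0 < D -> 0 <= l ->
  (forall x, a <= X x <= a + D) ->
  (\int[P]_x (expR (l * (X x - fine (\int[P]_x (X x)%:E))))%:E
     <= (expR (l ^+ 2 * D ^+ 2 / 8))%:E)%E.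
Proof.
move=> mX D0 l0 Xab; have iX := bounded_integrable mX Xab.
set mu := fine _.
have muE : (\int[P]_x (X x)%:E = mu%:E)%E.
  by rewrite /mu fineK //; exact: (integrable_fin_num measurableT iX).
have amu : a <= mu <= a + D.
  rewrite -!lee_fin -muE -(integral_cst_prob a) -(integral_cst_prob (a + D)).
  by apply/andP; split; apply: le_integral => //; try exact: integrable_cst;
    move=> x _; rewrite lee_fin; have /andP[] := Xab x.
pose h := l * D; pose e := expR h.
pose A := expR (l * (a - mu)).
pose f x := A * (1 - (X x - a) / D + (X x - a) / D * e).
have AE : A * (1 - (mu - a) / D + (mu - a) / D * e) <= expR (l ^+ 2 * D ^+ 2 / 8).
  have /andP[m1 m2] := amu; have q01 : 0 <= (mu - a) / D <= 1.
    by rewrite ler_pdivrMr // mul1r lerBlDl; rewrite divr_ge0 ?subr_ge0 // ltW.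
  have := bernoulli_mgf q01 (mulr_ge0 l0 (ltW D0)); rewrite -/h -/e.
  move/(ler_wpM2l (expR_ge0 (l * (a - mu)))); rewrite -/A => /le_trans; apply.
  rewrite -expRD ler_expR /h exprMn.
  by rewrite [X in _ + (X + _)](_ : _ = l * (mu - a)); [lra|field; lra].
apply: (@le_trans _ _ (\int[P]_x (f x)%:E)%E).
  apply: ge0_le_integral => //.
  - apply/measurable_EFinP; apply: measurableT_comp => //.
    by apply: measurable_funM => //; apply: measurable_funB.
  - apply/measurable_EFinP; apply: measurable_funM => //.
    by apply: measurable_funD; first apply: measurable_funB => //;
      repeat (apply: measurable_funM => //); apply: measurable_funB.
  - move=> x _; rewrite lee_fin /f.
    have /andP[h1 h2] := Xab x.
    have u01 : 0 <= (X x - a) / D <= 1.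
      by rewrite ler_pdivrMr // mul1r lerBlDl; rewrite divr_ge0 ?subr_ge0 // ltW.
    have := expR_chord u01 (mulr_ge0 l0 (ltW D0)); rewrite -/h -/e.
    move/(ler_wpM2l (expR_ge0 (l * (a - mu)))); rewrite -/A; apply: le_trans.
    rewrite -expRD ler_expR /h.
    by rewrite [leRHS](_ : _ = l * (X x - mu)) //; field; lra.
rewrite (_ : (\int[P]_x (f x)%:E)%E = (A * (1 - (mu - a) / D + (mu - a) / D * e))%:E) ?lee_fin //.
pose B := A * (e - 1) / D; pose C := A - a * B.
have fE (y : R) : A * (1 - (y - a) / D + (y - a) / D * e) = C + B * y.
  by rewrite /C /B; field; lra.
rewrite fE /f; under eq_integral do rewrite fE EFinD EFinM.
rewrite integralD //.
- by rewrite integral_cst_prob integralZl // muE.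
- exact: integrableZl.
Qed.
End Tail.

Section Concentration.
Context {d : measure_display} {T : measurableType d} {R : realType}.
Variables (P : probability T R) (n : nat).

Let mean (Y : T -> R) := fine (\int[P]_x (Y x)%:E).

Lemma independent_rvsN (X : 'I_n -> T -> R) :
  independent_rvs P X -> independent_rvs P (fun i x => - X i x).
Proof.
move=> [mX iX]; split=> [i|B mB]; first exact: measurableT_comp.
have mNB i : measurable (-%R @^-1` B i) by rewrite -[X in measurable X]setTI; exact: oppr_measurable.
exact: (iX (fun i => -%R @^-1` B i)).
Qed.

Lemma hoeffding_upper (X : 'I_n -> T -> R) (a D s : R) : independent_rvs P X ->
  0 < D -> 0 < s -> (forall i x, a <= X i x <= a + D) ->
  (P [set x | (n%:R * s <= \sum_i (X i x - mean (X i)))%R]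
    <= (expR (- (2 * n%:R * s ^+ 2 / D ^+ 2)))%:E)%E.
Proof.
move=> indX D0 s0 Xab; have mX i : measurable_fun setT (X i) by have [] := indX.
(* Minimiser of the Chernoff exponent [- l n s + n l ^ 2 D ^ 2 / 8]. *)
pose l := 4 * s / D ^+ 2.
have l0 : 0 < l by rewrite divr_gt0 ?exprn_gt0 // mulr_gt0.
pose S x := \sum_i (X i x - mean (X i)).
have mS : measurable_fun setT S.
  by apply: measurable_sum => i; apply: measurable_funB.
have mE : measurable_fun setT (fun x => expR (l * (S x - n%:R * s))).
  apply: measurableT_comp => //; apply: measurable_funM => //; exact: measurable_funB.
pose E := [set x | n%:R * s <= S x].
have mEv : measurable E.
  rewrite (_ : E = S @^-1` `[n%:R * s, +oo[); last first.
    by apply/seteqP; split=> x; rewrite /E /= in_itv /= andbT.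
  by rewrite -[X in measurable X]setTI; apply: mS.
(* Markov's inequality: the exponential dominates the indicator of [E]. *)
apply: (@le_trans _ _ (\int[P]_x (expR (l * (S x - n%:R * s)))%:E)%E).
  change (P E <= \int[P]_x (expR (l * (S x - n%:R * s)))%:E)%E.
  rewrite -[in leLHS](setIT E) -integral_indic //.
  apply: ge0_le_integral => //.
  - by apply/measurable_EFinP.
  - by apply/measurable_EFinP.
  - move=> x _; rewrite lee_fin indicE.
    have [/set_mem h|_] := boolP (x \in E); last exact: expR_ge0.
    by rewrite /= -[leLHS]expR0 ler_expR mulr_ge0 ?subr_ge0 // ltW.
(* The truncation is harmless on the range of [X i] and makes [g i] bounded. *)
pose g i y := expR (l * (Num.min y (a + D) - mean (X i))).
pose K := \sum_i expR (l * (a + D - mean (X i))).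
have mg i : measurable_fun setT (g i).
  apply: measurableT_comp => //; apply: measurable_funM => //; apply: measurable_funB => //.
  exact: measurable_minr.
have gK i y : 0 <= g i y <= K.
  rewrite expR_ge0 /K (bigD1 i) //= ler_wpDr //.
    by apply: sumr_ge0 => j _; exact: expR_ge0.
  by rewrite ler_expR ler_pM2l // lerB // ge_min lexx orbT.
have gE i x : g i (X i x) = expR (l * (X i x - mean (X i))).
  by rewrite /g min_l //; have /andP[] := Xab i x.
have -> : (\int[P]_x (expR (l * (S x - n%:R * s)))%:E =
    (expR (- (l * (n%:R * s))))%:E * \int[P]_x (\prod_i g i (X i x))%:E)%E.
  rewrite -ge0_integralZl_EFin ?expR_ge0 //.
  - apply: eq_integral => x _; rewrite -EFinM; congr EFin.
    under eq_bigr do rewrite gE.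
    by rewrite -expR_sum -expRD -mulr_sumr; congr expR; rewrite /S; ring.
  - by move=> x _; rewrite lee_fin; apply: prodr_ge0 => i _; have /andP[] := gK i (X i x).
  - apply/measurable_EFinP; apply: measurable_prod => i _.
    exact: (measurableT_comp (mg i) (mX i)).
rewrite (integral_prod_indep indX mg gK).
apply: (@le_trans _ _ ((expR (- (l * (n%:R * s))))%:E *
    \prod_(i < n) (expR (l ^+ 2 * D ^+ 2 / 8))%:E)%E).
  apply: lee_wpmul2l; first by rewrite lee_fin expR_ge0.
  suff /andP[_ ->] : (0 <= \prod_i \int[P]_x (g i (X i x))%:E
      <= \prod_(i < n) (expR (l ^+ 2 * D ^+ 2 / 8))%:E)%E by [].
  elim/big_ind2: _ => [|x1 x2 y1 y2 /andP[x10 h1] /andP[y10 h2]|i _].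
  - by rewrite lexx lee01.
  - by rewrite mule_ge0 // lee_pmul.
  - rewrite integral_ge0 /=; last by move=> x _; rewrite lee_fin; have /andP[] := gK i (X i x).
    under eq_integral do rewrite gE.
    exact: hoeffding_mgf (ltW l0) (Xab i).
rewrite prodEFin -EFinM lee_fin -expR_sum -expRD ler_expR.
rewrite sumr_const card_ord -mulr_natl /l.
rewrite le_eqVlt; apply/orP; left; apply/eqP; field; lra.
Qed.

End Concentration.

Section Hoeffding.
Context {d : measure_display} {T : measurableType d} {R : realType}.
Variables (P : probability T R) (n : nat).

Lemma hoeffding (X : 'I_n -> T -> R) (a D s : R) : (0 < n)%N -> independent_rvs P X ->
  0 < D -> 0 < s -> (forall i x, a <= X i x <= a + D) ->
  let mean_X := fun x => (\sum_(i < n) X i x) / n%:R in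
  (P [set x | s%:E <= `|(mean_X x)%:E - 'E_P[mean_X]|]
    <= (2 * expR (- (2 * n%:R * s ^+ 2 / D ^+ 2)))%:E)%E.
Proof.
move=> n0 indX D0 s0 Xab /=; have [mX _] := indX.
have nR : 0 < n%:R :> R by rewrite ltr0n.
have iX i : P.-integrable setT (fun x => (X i x)%:E) := bounded_integrable P (mX i) (Xab i).
pose mu i := fine (\int[P]_x (X i x)%:E).
have muE i : (\int[P]_x (X i x)%:E = (mu i)%:E)%E.
  by rewrite /mu fineK //; exact: (integrable_fin_num measurableT (iX i)).
have -> : ('E_P[fun x => ((\sum_i X i x) / n%:R)%R] = ((\sum_i mu i) / n%:R)%:E)%E.
  rewrite unlock; under eq_integral => x _ do rewrite mulrC EFinM -sumEFin.
  rewrite integralZl //; last exact: integrable_sum.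
  rewrite integral_sum //.
  by rewrite mulrC EFinM -sumEFin; congr (_ * _)%E; apply: eq_bigr.
pose S x := \sum_i (X i x - mu i).
have SE x : (\sum_i X i x) / n%:R - (\sum_i mu i) / n%:R = S x / n%:R.
  by rewrite /S sumrB mulrBl.
have mS : measurable_fun setT S.
  by apply: measurable_sum => i; apply: measurable_funB.
have mlev (f : T -> R) t : measurable_fun setT f -> measurable [set x | t <= f x].
  move=> mf; rewrite (_ : [set _ | _] = f @^-1` `[t, +oo[); last first.
    by apply/seteqP; split=> x; rewrite /= in_itv /= andbT.
  by rewrite -[X in measurable X]setTI; apply: mf.
have mNS : measurable_fun setT (fun x => - S x) by exact: measurableT_comp.
have NmuE i : fine (\int[P]_x (- X i x)%:E) = - mu i.
  under eq_integral => x _ do rewrite -mulN1r EFinM.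
  by rewrite integralZl // muE -EFinM mulN1r.
have up := hoeffding_upper indX D0 s0 Xab.
(* The lower tail is the upper tail of the negated variables, which lie in an interval of the same
   length. *)
have NXab i x : - (a + D) <= - X i x <= - (a + D) + D.
  by have /andP[] := Xab i x; lra.
have lo := hoeffding_upper (independent_rvsN indX) D0 s0 NXab.
rewrite [X in (P X <= _)%E](_ : _ = [set x | n%:R * s <= S x] `|` [set x | n%:R * s <= - S x]); last first.
  apply/seteqP; split=> x /=; rewrite SE lee_fin normrM normfV (gtr0_norm nR) ler_pdivlMr // ler_normr (mulrC s).
    by case/orP; [left|right].
  by case=> ->; rewrite ?orbT.
apply: le_trans (measureU2 _ (mlev _ _ mS) (mlev _ _ mNS)) _.
rewrite (mulr_natl (expR _) 2) mulr2n EFinD leeD //.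
move: lo; under [in X in X -> _]eq_fun do under eq_bigr do rewrite NmuE -opprD.
by under eq_fun do rewrite sumrN.
Qed.

End Hoeffding.

Unset Implicit Arguments.

Theorem theorem1 (R : realType) (d : measure_display) (T : measurableType d)
  (P : probability T R) (m n : nat) (M : 'I_m) (gamma : R)
  (w : 'I_n -> T -> 'I_m -> R) :
  (0 <= gamma <= 1) ->
  (0 < n)%N ->
  (* individual weights are nonnegative *)
  (forall i x j, 0 <= w i x j) ->
  (* every data point is correctly classified by the ensemble *)
  (forall i x, gamma <= \sum_(j < m) w i x j) ->
  (* the known error bound of the expected-marginal-contributions approximation *)
  (forall i x, - Num.sqrt (8 / (m%:R * pi)) <= shapley_approx_error (w i x) gamma M
                <= Num.sqrt (8 / (m%:R * pi))) ->
  independent_rvs P (fun i x => shapley_approx_error (w i x) gamma M) ->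
  forall eps : R, 0 < eps ->
  let mean_err := fun x => (\sum_(i < n) shapley_approx_error (w i x) gamma M) / n%:R in
  (P [set x | eps%:E <= `| (mean_err x)%:E - 'E_P[mean_err] |]
    <= (2 * expR (- Num.sqrt (n%:R ^+ 2 * m%:R * eps ^+ 4 * pi / 8)))%:E)%E.
Proof.
move=> /andP[g0 _] n0 w0 wg bound ind eps eps0.
have m0 : (0 < m)%N by exact: leq_ltn_trans (leq0n M) (ltn_ord M).
have c2 := @sqr_known_bound R m m0; have D2 := @sqr_error_width R m.
have mpi : 0 < m%:R * pi :> R by rewrite mulr_gt0 ?ltr0n ?pi_gt0.
have c0 : 0 < @known_bound R m by rewrite sqrtr_gt0 divr_gt0.
have D0 : 0 < @error_width R m by rewrite sqrtr_gt0 mulr_gt0.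
have range i x := error_range (M := M) (w0 i x) g0 (wg i x) (bound i x).
have := hoeffding n0 ind D0 eps0 range; rewrite D2 /= => /le_trans; apply.
rewrite lee_fin ler_pM2l // ler_expR lerN2.
(* With [D ^ 2 = 2 c] the Hoeffding exponent is [n eps ^ 2 / c], and its square is the radicand
   because [c ^ 2 = 8 / (m pi)]. *)
have -> : n%:R ^+ 2 * m%:R * eps ^+ 4 * pi / 8 = (2 * n%:R * eps ^+ 2 / (2 * known_bound m)) ^+ 2.
  have -> : (2 * n%:R * eps ^+ 2 / (2 * known_bound m)) ^+ 2
      = n%:R ^+ 2 * eps ^+ 4 / known_bound m ^+ 2 :> R.
    by field; rewrite gt_eqF.
  rewrite c2; have m0R : m%:R != 0 :> R by rewrite pnatr_eq0 -lt0n.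
  have := lt0r_neq0 (pi_gt0 R); generalize (pi : R) => p p0.
  by field; rewrite m0R p0.
rewrite sqrtr_sqr ger0_norm // divr_ge0 ?mulr_ge0 ?ler0n ?sqr_ge0 ?ltW //.
Qed.
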